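(* Let $$g(x)=\frac16-2\Big(x-\big[x+\tfrac12\big]\Big)^2,\qquad x\in\mathbb R .$$ Then $g$ is a continuous periodic function of period $1$ with mean value zero. Moreover, let $N(t)$ be the eigenvalue counting function of $-\Delta$ on the unit sphere $S^2$, let $\widetilde N(t)=t+\frac13$, and let $A(t)=\frac1t\int_0^t\big(N(s)-\widetilde N(s)\big)\,ds$ for $t>0$. Then $$A(t)=g\Big(\sqrt{t+\tfrac14}\Big)+O(t^{-1/2})\qquad\text{as } t\to\infty.$$
   Context: $[x]$ denotes the greatest integer $\le x$. $S^2$ is the round 2-sphere of radius 1 in $\mathbb R^3$. The eigenvalue counting function of an operator with discrete spectrum $0\le\lambda_1\le\lambda_2\le\cdots\to\infty$ (repeated according to multiplicity) is $N(t)=\#\{j:\lambda_j\le t\}$. On $S^2$, the eigenvalues of $-\Delta$ are $k(k+1)$, $k=0,1,2,\ldots$, with multiplicity $2k+1$. The mean value of a periodic function is its average over a period. *)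

(* Defs.v *)
From Stdlib Require Import Reals Lra List.
From Coquelicot Require Import Coquelicot.
Open Scope R_scope.

Definition point : Type := (R * R * R)%type.

Definition origin : point := (0, 0, 0).

Definition norm3 (p : point) : R :=
  let '(x, y, z) := p in sqrt (x ^ 2 + y ^ 2 + z ^ 2).

Definition S2 (p : point) : Prop := norm3 p = 1.

Inductive axis : Type := Ax | Ay | Az.

Definition coord (i : axis) (p : point) : R :=
  let '(x, y, z) := p in
  match i with Ax => x | Ay => y | Az => z end.

Definition set_coord (i : axis) (p : point) (u : R) : point :=
  let '(x, y, z) := p in
  match i with Ax => (u, y, z) | Ay => (x, u, z) | Az => (x, y, u) end.

Definition ex_partial (i : axis) (F : point -> R) (p : point) : Prop :=
  ex_derive (fun u => F (set_coord i p u)) (coord i p).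

Definition partial (i : axis) (F : point -> R) (p : point) : R :=
  Derive (fun u => F (set_coord i p u)) (coord i p).

Definition partials (l : list axis) (F : point -> R) : point -> R :=
  fold_right partial F l.

(* C^infinity on the open set R^3 \ {0}. *)
Definition smooth_off_origin (F : point -> R) : Prop :=
  forall (l : list axis) (p : point), p <> origin ->
    continuous (partials l F) p /\ forall i, ex_partial i (partials l F) p.

Definition laplacian3 (F : point -> R) (p : point) : R :=
  partial Ax (partial Ax F) p + partial Ay (partial Ay F) p
  + partial Az (partial Az F) p.

(* A function on S^2 is represented by any f : point -> R; only its values on
   S^2 matter below.  [extend0 f] is its extension to R^3 \ {0} that is
   constant along rays (the value at the origin is irrelevant). *)
Definition extend0 (f : point -> R) (p : point) : R :=
  let '(x, y, z) := p in
  f (x / norm3 p, y / norm3 p, z / norm3 p).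

Definition smooth_S2 (f : point -> R) : Prop := smooth_off_origin (extend0 f).

(* The Laplace-Beltrami operator of the round unit sphere: the Euclidean
   Laplacian of the extension that is constant in the radial direction,
   restricted to the sphere. *)
Definition laplacian_S2 (f : point -> R) (p : point) : R :=
  laplacian3 (extend0 f) p.

(* L^2 eigenfunctions of the Laplacian on a closed surface are smooth, and the
   eigenvalues are real, so that smooth real-valued eigenfunctions give the
   whole spectrum with the right multiplicities. *)
Definition eigenspace (mu : R) (f : point -> R) : Prop :=
  smooth_S2 f /\ forall p, S2 p -> - laplacian_S2 f p = mu * f p.

(* The space E of functions on S^2 has dimension n: e 1, ..., e n is a basis
   (the sums below are empty when n = 0). *)
Definition has_dim_S2 (E : (point -> R) -> Prop) (n : nat) : Prop :=
  exists e : nat -> point -> R,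
    (forall i, (1 <= i <= n)%nat -> E (e i)) /\
    (forall c : nat -> R,
       (forall p, S2 p -> sum_n_m (fun i => c i * e i p) 1 n = 0) ->
       forall i, (1 <= i <= n)%nat -> c i = 0) /\
    (forall f, E f ->
       exists c : nat -> R,
         forall p, S2 p -> f p = sum_n_m (fun i => c i * e i p) 1 n).

Definition has_card (S : nat -> Prop) (n : nat) : Prop :=
  exists l : list nat,
    NoDup l /\ length l = n /\ forall j, In j l <-> S j.

(* lam 0 <= lam 1 <= ... lists the eigenvalues of minus the Laplacian on S^2,
   each real mu occurring exactly dim (eigenspace mu) times (0 times if mu is
   not an eigenvalue). *)
Definition eigenvalue_sequence_S2 (lam : nat -> R) : Prop :=
  0 <= lam 0%nat /\
  (forall j, lam j <= lam (S j)) /\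
  is_lim_seq lam p_infty /\
  (forall mu, exists n,
     has_dim_S2 (eigenspace mu) n /\ has_card (fun j => lam j = mu) n).

Definition counting_function (lam : nat -> R) (N : R -> nat) : Prop :=
  forall t, has_card (fun j => lam j <= t) (N t).

Definition Ntilde (t : R) : R := t + 1 / 3.

Definition average_error (N : R -> nat) (t : R) : R :=
  / t * RInt (fun s => INR (N s) - Ntilde s) 0 t.

(* Int_part is the greatest integer below or equal to its argument. *)
Definition g (x : R) : R := 1 / 6 - 2 * (x - IZR (Int_part (x + 1 / 2))) ^ 2.

Definition mean_value (f : R -> R) (T : R) : R := / T * RInt f 0 T.

(* Main.v *)
(* Let A, B, C be the infinitesimal rotations of R^3. On functions constant along
   rays, A^2 + B^2 + C^2 is r^2 times the Laplacian, so an eigenspace of the sphere is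
   a space of such functions on which A^2 + B^2 + C^2 = -mu, stable under A, B, C,
   that is, a representation of so(3), finite-dimensional by hypothesis.
   After complexification, a vector killed by the raising operator
   and of weight w obeys first-order equations that determine it from its value at
   (1,0,0), force w to be an integer (going round the equator) and exclude w < 0
   (blow-up at the pole). Hence the kernel of the raising operator is a line of
   weight k with mu = k(k+1), and the dimension, being the nilpotency index of the
   raising operator, is 2k+1; the functions ((x+iy)/r)^k show that every k occurs.
   Therefore N(t) = m^2 with m = [x + 1/2], x = sqrt(t + 1/4), and
   int_0^t (N - Ntilde) = -(t - m^2)^2/2 + m^2/2 - t/3, in which one substitutes
   x = m + y with |y| <= 1/2. *)

Require Import Defs.
From Stdlib Require Import Reals Lra Lia List Classical ZArith.
From Coquelicot Require Import Coquelicot.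
From HB Require structures.
From mathcomp Require all_boot all_order all_algebra ring complex Rstruct.
Open Scope R_scope.

(** * Representations of so(3) *)

(** An eigenspace comes with a finite dimension but with no inner product, so the weight operator
    [H] is not known to be diagonalizable. The decomposition into weight spaces is therefore
    replaced by polynomial identities between [H] and the powers of the raising operator [X]. From
    analysis the algebra receives two facts: the kernel of [X] contains no nonzero vector of
    negative weight, and its rank is at most one. The parameter [j] is at first merely the
    nonnegative real root of j(j+1) = mu; it becomes an integer once an actual highest weight
    function is available. Because the dimension is rigid, a single nonzero eigenfunction for k(k+1)
    already forces multiplicity 2k+1. As for the constant in [Ntilde]: with t close to m^2 + 2my,
    the integral of the error is about -2 m^2 y^2 + m^2/2 - m^2/3, that is, t (1/6 - 2 y^2). The
    term 1/3 is what makes the limit profile have mean zero, since 1/2 - 1/3 = 1/6 is the average of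
    2 y^2 over [-1/2, 1/2]. *)

Module RotationAlgebra.
Import structures all_boot all_order all_algebra ring complex.
Set Implicit Arguments. Unset Strict Implicit. Unset Printing Implicit Defensive.
Import Order.TTheory GRing.Theory Num.Theory.
Local Open Scope ring_scope.

Section RaisingOperator.
Variables (K : numFieldType) (n : nat) (H X Y : 'M[K]_n.+1) (j : K).
Hypothesis (j_ge0 : 0 <= j).
Hypothesis XH : X *m H = H *m X + X.
Hypothesis YH : Y *m H = H *m Y - Y.
Hypothesis XY : X *m Y = (j * (j + 1))%:M - H *m H - H.
Hypothesis YX : Y *m X = (j * (j + 1))%:M - H *m H + H.

Lemma exprXH i : X ^+ i *m H = H *m X ^+ i + X ^+ i *+ i.
Proof.
elim: i => [|i IH]; first by rewrite expr0 mul1mx mulmx1 mulr0n addr0.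
rewrite exprSr -!mulmxE -mulmxA XH mulmxDr mulmxA IH mulmxDl -mulmxA.
rewrite -addrA; congr (_ + _); rewrite mulrSr; congr (_ + _).
by rewrite !mulmxE -mulrnAl.
Qed.

Definition ad_weight (M : 'M[K]_n.+1) := M *m H - H *m M.

Lemma ad_weight_linear : linear ad_weight.
Proof.
move=> c u v; rewrite /ad_weight mulmxDl mulmxDr -scalemxAl -scalemxAr.
by rewrite scalerBr opprD addrACA.
Qed.
HB.instance Definition _ := GRing.isLinear.Build K _ _ _ ad_weight ad_weight_linear.

(* The powers of [X] are eigenvectors of [ad H] for the eigenvalues 0, 1, 2, ...,
   of which only finitely many occur. *)
Lemma X_nilpotent : exists m, X ^+ m = 0.
Proof.
pose d := (n.+1 * n.+1)%N.
have [|nz] := boolP [exists i : 'I_d.+1, X ^+ i == 0].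
  by case/existsP=> i /eqP; exists i.
have inj : {in xpredT &, injective (fun i : 'I_d.+1 => (i : nat)%:R : K)}.
  by move=> a b _ _ /eqP; rewrite eqr_nat => /eqP/val_inj.
have := mxdirect_sum_eigenspace (lin_mx ad_weight) inj; move/mxdirectP => /= Hd.
have := rank_leq_row (\sum_(i : 'I_d.+1) eigenspace (lin_mx ad_weight) (i : nat)%:R)%MS.
rewrite Hd leqNgt; case/negP.
have: (\sum_(i < d.+1) 1 <=
       \sum_(i < d.+1) \rank (eigenspace (lin_mx ad_weight) (i : nat)%:R))%N.
  apply: leq_sum => i _; rewrite lt0n mxrank_eq0; apply/eqP => E0.
  have: (mxvec (X ^+ i) <= eigenspace (lin_mx ad_weight) (i : nat)%:R)%MS.
    apply/eigenspaceP.
    rewrite mul_vec_lin /= /ad_weight exprXH addrC addKr -linearZ /=.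
    by rewrite scaler_nat.
  rewrite E0 submx0 => /eqP/(congr1 vec_mx); rewrite mxvecK linear0 => Z.
  by move/existsP: nz; apply; exists i; rewrite Z.
by rewrite sum1_card card_ord.
Qed.

Implicit Types v : 'rV[K]_n.+1.

Hypothesis no_negative : forall v (w : K), w < 0 -> v *m X = 0 -> v *m H = w *: v -> v = 0.
Hypothesis rank_ker : (\rank (kermx X) <= 1)%N.

(** On the kernel of [X] the relation [XY] reads (H - j)(H + j + 1) = 0. Hence vH - jv is a kernel
    vector of weight -(j + 1) < 0 and must vanish. *)
Lemma kerX_weight v : v *m X = 0 -> v *m H = j *: v.
Proof.
move=> vX.
have vHX : v *m H *m X = 0.
  have : v *m (X *m H) = v *m (H *m X + X) by rewrite XH.
  by rewrite mulmxA vX mul0mx mulmxDr vX addr0 mulmxA.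
have vXY : j * (j + 1) *: v - v *m H *m H - v *m H = 0.
  have : v *m (X *m Y) = v *m ((j * (j + 1))%:M - H *m H - H) by rewrite XY.
  by rewrite mulmxA vX mul0mx !mulmxBr mul_mx_scalar mulmxA => <-.
apply/eqP; rewrite -subr_eq0; apply/eqP.
apply: (no_negative (w := - (j + 1))).
- by rewrite oppr_lt0 ltr_wpDl.
- by rewrite mulmxBl vHX -scalemxAl vX scaler0 subr0.
rewrite mulmxBl -scalemxAl; move: vXY.
move: (v *m H *m H) (v *m H) => a b /rowP e; apply/rowP => l.
have /eqP := e l; rewrite !mxE addrAC subr_eq0 => /eqP <-; ring.
Qed.

(* The roots are the weights that can occur in the kernel of [X ^+ i]. *)
Fixpoint prodH i : 'M[K]_n.+1 :=
  if i is i'.+1 then (H - (j - i'%:R)%:M) *m prodH i' else 1%:M.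

Lemma prodH_eigen i v w : v *m H = w *: v ->
  v *m prodH i = \prod_(l < i) (w - j + l%:R) *: v.
Proof.
move=> vH; elim: i => [|i IH] /=; first by rewrite big_ord0 mulmx1 scale1r.
rewrite big_ord_recr mulmxA mulmxBr vH mul_mx_scalar -scalerBl -scalemxAl IH.
by rewrite scalerA mulrC; congr (_ *: _); congr (_ * _); ring.
Qed.

Lemma mulHXn i v : v *m H *m X ^+ i = v *m X ^+ i *m H - i%:R *: (v *m X ^+ i).
Proof. by rewrite -!mulmxA exprXH -scaler_nat mulmxDr -scalemxAr addrK. Qed.

Lemma prodH_comm i : H *m prodH i = prodH i *m H.
Proof.
elim: i => [|i IH] /=; first by rewrite mul1mx mulmx1.
rewrite -mulmxA -IH !mulmxA; congr (_ *m _).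
by rewrite mulmxBr mulmxBl mul_mx_scalar mul_scalar_mx.
Qed.

(** If v is killed by X^(i+1), then vX^i has weight j. Moving [H] back across X^i costs i, so v has
    weight j - i modulo the kernel of X^i, and one factor of the product brings v into that
    kernel. *)
Lemma kerXn_prodH i v : v *m X ^+ i = 0 -> v *m prodH i = 0.
Proof.
elim: i v => [|i IH] v /=; first by rewrite expr0 !mulmx1.
rewrite exprSr -mulmxE mulmxA => /kerX_weight vXi.
rewrite mulmxA; apply: IH; rewrite mulmxBr mulmxBl mulHXn vXi.
by rewrite mul_mx_scalar -scalemxAl -!scalerBl -[RHS](scale0r (v *m X ^+ i));
  congr (_ *: _); ring.
Qed.

(** For i = m the scalar is a product of l - m with l < m, nonzero in characteristic 0. So
    multiplying by [prodH m] does not destroy a vector that survives X^m. *)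
Lemma prodH_Xn i m v : v *m X ^+ m.+1 = 0 ->
  v *m prodH i *m X ^+ m = \prod_(l < i) (l%:R - m%:R) *: (v *m X ^+ m).
Proof.
elim: i v => [|i IH] v vX /=; first by rewrite big_ord0 mulmx1 scale1r.
have vXm : v *m X ^+ m *m H = j *: (v *m X ^+ m).
  by apply: kerX_weight; rewrite -mulmxA mulmxE -exprSr.
have e : v *m (H - (j - i%:R)%:M) *m X ^+ m = (i%:R - m%:R) *: (v *m X ^+ m).
  rewrite mulmxBr mulmxBl mulHXn vXm mul_mx_scalar -scalemxAl -!scalerBl.
  by congr (_ *: _); ring.
rewrite mulmxA IH; last first.
  by rewrite exprSr -mulmxE mulmxA e -scalemxAl -mulmxA mulmxE -exprSr vX scaler0.
by rewrite e scalerA big_ord_recr.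
Qed.

(* A vector of lowest weight [w = j - m] is killed by [Y], so that [YX] gives
   [j (j + 1) = w (w - 1)]. *)
Lemma nilpotency_index m : X ^+ m.+1 = 0 -> X ^+ m != 0 -> m.+1%:R = 2 * j + 1.
Proof.
move=> Xm1 Xm.
have [f fX] : exists f : 'rV_n.+1, f *m X ^+ m != 0.
  have /rowV0Pn[_ /submxP[f ->] fX] := Xm; by exists f.
(* [prodH m.+1] kills every vector, since X^(m+1) = 0; leaving out its factor with root j - m
   produces an eigenvector of exactly that weight. *)
pose u := f *m prodH m; have [w wE] : {w | w = j - m%:R} by exists (j - m%:R).
have uX : u *m X ^+ m != 0.
  rewrite prodH_Xn; last by rewrite Xm1 mulmx0.
  rewrite scaler_eq0 negb_or fX andbT prodf_seq_neq0; apply/allP => l _ /=.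
  by rewrite subr_eq0 eqr_nat neq_ltn ltn_ord.
have uH : u *m H = w *: u.
  have : f *m prodH m.+1 = 0 by apply: kerXn_prodH; rewrite Xm1 mulmx0.
  rewrite /= mulmxBl prodH_comm mul_scalar_mx mulmxBr mulmxA -wE -scalemxAr.
  by move/eqP; rewrite subr_eq0 => /eqP.
have uYH : u *m Y *m H = (w - 1) *: (u *m Y).
  by rewrite -mulmxA YH mulmxBr mulmxA uH -scalemxAl scalerBl scale1r.
(* uY would have weight j - m - 1, which is not a root of [prodH m.+1], whereas this product
   annihilates the whole space. *)
have uY : u *m Y = 0.
  have /eqP : u *m Y *m prodH m.+1 = 0 by apply: kerXn_prodH; rewrite Xm1 mulmx0.
  rewrite (prodH_eigen _ uYH) scaler_eq0 => /orP[|/eqP //].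
  rewrite prodf_seq_eq0 => /hasP[l _ /=].
  have -> : w - 1 - j + l%:R = l%:R - m.+1%:R by rewrite wE; ring.
  by rewrite subr_eq0 eqr_nat => /eqP E; have := ltn_ord l; rewrite E ltnn.
have u0 : u != 0 by apply: contraNneq uX => ->; rewrite mul0mx.
have : u *m (Y *m X) = 0 by rewrite mulmxA uY mul0mx.
rewrite YX mulmxDr mulmxBr mul_mx_scalar mulmxA uH -scalemxAl uH scalerA.
rewrite -scalerBl -scalerDl => /eqP; rewrite scaler_eq0 (negPf u0) orbF.
have -> : j * (j + 1) - w * w + w = (2 * j + 1 - m.+1%:R) * m.+1%:R.
  by rewrite wE; ring.
by rewrite mulf_eq0 pnatr_eq0 orbF subr_eq0 => /eqP.
Qed.

(** Each further factor [X] lowers the rank by the dimension of im X^i ∩ ker X. This is at most 1 by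
    [rank_ker], and at least 1 because it contains the nonzero rows of X^m. *)
Lemma rank_Xn m i : X ^+ m.+1 = 0 -> X ^+ m != 0 -> (i <= m.+1)%N ->
  (\rank (X ^+ i) + i)%N = n.+1.
Proof.
move=> Xm1 Xm; elim: i => [|i IH] lt_im; first by rewrite addn0 expr0 mxrank1.
apply: etrans (IH (ltnW lt_im)); rewrite addnS -addSn; congr (_ + _)%N.
rewrite -(mxrank_mul_ker (X ^+ i) X) exprSr -mulmxE -addn1; congr (_ + _)%N.
apply/eqP; rewrite eqn_leq (leq_trans (mxrankS (capmxSr _ _)) rank_ker) andbT.
rewrite lt0n mxrank_eq0; apply: contraNneq Xm => cap0.
rewrite -submx0 -cap0 sub_capmx sub_kermx mulmxE -exprSr Xm1 eqxx andbT.
by rewrite -(subnK (lt_im : (i <= m)%N)) exprD -mulmxE submxMl.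
Qed.

Lemma dim_eq : n.+1%:R = 2 * j + 1.
Proof.
have ex : exists m, X ^+ m == 0 by have [m Xm] := X_nilpotent; exists m; rewrite Xm.
have [[|m] /eqP Xm min] := ex_minnP ex.
  by have /eqP := Xm; rewrite expr0 oner_eq0.
have Xm' : X ^+ m != 0 by apply/negP => /min; rewrite ltnn.
rewrite -(nilpotency_index Xm Xm'); congr _%:R; rewrite -[LHS](rank_Xn Xm Xm' (leqnn _)) Xm.
by rewrite mxrank0 add0n.
Qed.

Lemma highest_weight_exists : exists2 v : 'rV[K]_n.+1, v != 0 & v *m X = 0 /\ v *m H = j *: v.
Proof.
have [m Xm] := X_nilpotent.
have : kermx X != 0.
  rewrite kermx_eq0 row_free_unit; apply/negP => uX.
  have := unitrX m (uX : X \is a GRing.unit).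
  by rewrite Xm unitr0.
case/rowV0Pn => v /sub_kermxP vX v0; exists v => //; split=> //.
exact: kerX_weight.
Qed.
End RaisingOperator.

(** * Ladder operators built from the rotation generators *)

Section Ladder.
Variables (K : fieldType) (n : nat) (A B C : 'M[K]_n.+1) (I : K) (mu : K).
Hypothesis II : I * I = -1.
Hypothesis AB : A *m B - B *m A = C.
Hypothesis BC : B *m C - C *m B = A.
Hypothesis CA : C *m A - A *m C = B.
Hypothesis casimir : A *m A + B *m B + C *m C = (- mu)%:M.
(** With L = -i(A, B, C), these are the angular momentum operators L_x + i L_y, L_x - i L_y and L_z,
    acting on row vectors from the right. *)
Let X := B - I *: A.
Let Y := - B - I *: A.
Let H := - I *: C.

(** These entrywise rules eliminate one order of each product. Once the remaining products are
    generalized to opaque matrices, the noncommutative identities below are linear in their entries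
    and fall to [ring]. *)
Let BA k l : (B *m A) k l = (A *m B) k l - C k l.
Proof. by rewrite -AB !mxE; ring. Qed.
Let CB k l : (C *m B) k l = (B *m C) k l - A k l.
Proof. by rewrite -BC !mxE; ring. Qed.
Let AC k l : (A *m C) k l = (C *m A) k l - B k l.
Proof. by rewrite -CA !mxE; ring. Qed.
Let AA k l : (A *m A) k l = (- mu)%:M k l - (B *m B) k l - (C *m C) k l.
Proof. by rewrite -casimir !mxE; ring. Qed.

Let normE := (mulmxDl, mulmxDr, mulmxN, mulNmx, scaleNr).

Lemma ladder_XH : X *m H = H *m X + X.
Proof.
apply/matrixP => k l.
rewrite /X /H !normE -?scalemxAl -?scalemxAr -?scalemxAl.
move: (CB k l) (AC k l).
move: (C *m B) (B *m C) (A *m C) (C *m A) => a b c d.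
rewrite !mxE => e1 e2; ring: II e1 e2.
Qed.

Lemma ladder_YH : Y *m H = H *m Y - Y.
Proof.
apply/matrixP => k l.
rewrite /Y /H !normE -?scalemxAl -?scalemxAr -?scalemxAl.
move: (CB k l) (AC k l).
move: (C *m B) (B *m C) (A *m C) (C *m A) => a b c d.
rewrite !mxE => e1 e2; ring: II e1 e2.
Qed.

Lemma ladder_XY : X *m Y = mu%:M - H *m H - H.
Proof.
apply/matrixP => k l.
rewrite /X /Y /H !normE -?scalemxAl -?scalemxAr -?scalemxAl.
move: (BA k l) (AA k l).
move: (A *m A) (B *m B) (C *m C) (B *m A) (A *m B)  => a b c d e.
rewrite !mxE => e1 e2.
ring: II e1 e2.
Qed.

Lemma ladder_YX : Y *m X = mu%:M - H *m H + H.
Proof.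
apply/matrixP => k l.
rewrite /X /Y /H !normE -?scalemxAl -?scalemxAr -?scalemxAl.
move: (BA k l) (AA k l).
move: (A *m A) (B *m B) (C *m C) (B *m A) (A *m B)  => a b c d e.
rewrite !mxE => e1 e2.
ring: II e1 e2.
Qed.
End Ladder.

(** * Real representations, through complexification *)

Section RealRotationAlgebra.
Variables (R : rcfType) (n : nat) (A B C : 'M[R]_n.+1) (j : R) (ev : 'cV[R]_n.+1).

(* [a + i b] is annihilated by [B - i A] and has weight [w] for [- i C]. *)
Definition hw_pair (w : R) (a b : 'rV[R]_n.+1) :=
  [/\ a *m C = - w *: b, b *m C = w *: a, a *m B = - (b *m A) & b *m B = a *m A].

Hypothesis j_ge0 : 0 <= j.
Hypothesis AB : A *m B - B *m A = C.
Hypothesis BC : B *m C - C *m B = A.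
Hypothesis CA : C *m A - A *m C = B.
Hypothesis casimir : A *m A + B *m B + C *m C = (- (j * (j + 1)))%:M.
Hypothesis no_negative : forall w a b, w < 0 -> hw_pair w a b -> a = 0 /\ b = 0.
Hypothesis ev_injective : forall w a b, hw_pair w a b ->
  a *m ev = 0 -> b *m ev = 0 -> a = 0 /\ b = 0.

Local Notation cx := (map_mx (real_complex R)).
Local Notation I := ('i%C : R[i]).
Let X := cx B - I *: cx A.
Let Y := - cx B - I *: cx A.
Let H := - I *: cx C.

Let re m p (v : 'M[R[i]]_(m, p)) : 'M[R]_(m, p) := map_mx (@complex.Re R) v.
Let im m p (v : 'M[R[i]]_(m, p)) : 'M[R]_(m, p) := map_mx (@complex.Im R) v.

Lemma cplx_split m p (v : 'M[R[i]]_(m, p)) : v = cx (re v) + I *: cx (im v).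
Proof. by apply/matrixP => k l; rewrite !mxE -complexE. Qed.

Lemma cplx_inj m p (a b a' b' : 'M[R]_(m, p)) :
  cx a + I *: cx b = cx a' + I *: cx b' -> a = a' /\ b = b'.
Proof.
move=> /matrixP e; split; apply/matrixP => k l; have := e k l; rewrite !mxE.
  by move/(congr1 (@complex.Re R)); simpc.
by move/(congr1 (@complex.Im R)); simpc.
Qed.

Lemma imag_sqr : I * I = -1. Proof. by rewrite -expr2 sqr_i. Qed.

Lemma hw_pairP (w : R) v : v *m X = 0 -> v *m H = w%:C%C *: v ->
  hw_pair w (re v) (im v).
Proof.
rewrite {1 2 3}(cplx_split v); move: (re v) (im v) => a b vX vH.
have {vX} : cx (a *m B + b *m A) + I *: cx (b *m B - a *m A) = cx 0 + I *: cx 0.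
  rewrite !map_mx0 scaler0 addr0 -vX /X mulmxDl !mulmxBr -?scalemxAl -?scalemxAr.
  rewrite scalerA imag_sqr scaleN1r opprK map_mxD map_mxB scalerBr !map_mxM /=.
  by rewrite [X in _ = _ + X]addrC [RHS]addrACA [X in _ = _ + X]addrC.
case/cplx_inj => /eqP; rewrite addr_eq0 => /eqP aB /eqP; rewrite subr_eq0 => /eqP bB.
have : cx (b *m C) + I *: cx (- (a *m C)) = cx (w *: a) + I *: cx (w *: b).
  rewrite !map_mxZ scalerA [I * _]mulrC -scalerA -scalerDr -vH /H.
  rewrite mulmxDl -?scalemxAl -?scalemxAr scalerA mulrN imag_sqr opprK scale1r addrC.
  by rewrite map_mxN !map_mxM /= scalerN scaleNr.
by case/cplx_inj => bC aC; split=> //; rewrite scaleNr -aC opprK.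
Qed.

Lemma so3_dimension : (n.+1)%:R = 2 * j + 1 /\
  exists a b, hw_pair j a b /\ (a != 0 \/ b != 0).
Proof.
have eAB : cx A *m cx B - cx B *m cx A = cx C by rewrite -!map_mxM -map_mxB AB.
have eBC : cx B *m cx C - cx C *m cx B = cx A by rewrite -!map_mxM -map_mxB BC.
have eCA : cx C *m cx A - cx A *m cx C = cx B by rewrite -!map_mxM -map_mxB CA.
pose J : R[i] := j%:C%C.
have eCas : cx A *m cx A + cx B *m cx B + cx C *m cx C = (- (J * (J + 1)))%:M.
  rewrite -!map_mxM -!map_mxD casimir map_scalar_mx rmorphN rmorphM rmorphD.
  by rewrite rmorph1.
have XH := ladder_XH imag_sqr eBC eCA : X *m H = H *m X + X.
have YH := ladder_YH imag_sqr eBC eCA : Y *m H = H *m Y - Y.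
have XY := ladder_XY imag_sqr eAB eCas : X *m Y = (J * (J + 1))%:M - H *m H - H.
have YX := ladder_YX imag_sqr eAB eCas : Y *m X = (J * (J + 1))%:M - H *m H + H.
have J_ge0 : 0 <= J by rewrite lecR.
have neg (v : 'rV_n.+1) (w : R[i]) : w < 0 -> v *m X = 0 -> v *m H = w *: v -> v = 0.
  (* In the order of [R[i]], w < 0 forces w to be real, so the real hypothesis on pairs applies. *)
  case: w => w w'; rewrite ltcE /= => /andP[/eqP e w0] vX vH.
  move: vH; rewrite -e => vH; have [a0 b0] := no_negative w0 (hw_pairP vX vH).
  by rewrite (cplx_split v) a0 b0 !map_mx0 scaler0 addr0.
have JH (v : 'rV_n.+1) := kerX_weight J_ge0 XH XY neg (v := v).
have rk : (\rank (kermx X) <= 1)%N.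
  (* The functional [ev] has a single column and is injective on the kernel of [X], which bounds the
     rank of that kernel by one. *)
  rewrite -(mxrank_mul_ker (kermx X) (cx ev)).
  have -> : (kermx X :&: kermx (cx ev) = 0)%MS.
    apply/eqP/rowV0P => v; rewrite sub_capmx => /andP[/sub_kermxP vX /sub_kermxP].
    rewrite {1}(cplx_split v) mulmxDl -scalemxAl -!map_mxM => e0.
    have {e0} : cx (re v *m ev) + I *: cx (im v *m ev) = cx 0 + I *: cx 0.
      by rewrite e0 !map_mx0 scaler0 addr0.
    case/cplx_inj => a0 b0.
    have [ra rb] := ev_injective (hw_pairP vX (JH v vX)) a0 b0.
    by rewrite (cplx_split v) ra rb !map_mx0 scaler0 addr0.
  by rewrite mxrank0 addn0 rank_leq_col.
split.
  have : (n.+1%:R)%:C%C = (2 * j + 1)%:C%C :> R[i].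
    by rewrite rmorph_nat (dim_eq J_ge0 XH YH XY YX neg rk) rmorphD rmorphM rmorph_nat rmorph1.
  by move/(congr1 (@complex.Re R)).
have [v v0 [vX vH]] := highest_weight_exists J_ge0 XH XY neg.
exists (re v), (im v); split; first exact: hw_pairP.
apply/orP; rewrite -negb_and; apply: contra v0 => /andP[/eqP a0 /eqP b0].
by rewrite (cplx_split v) a0 b0 !map_mx0 scaler0 addr0.
Qed.
End RealRotationAlgebra.

End RotationAlgebra.

(** * Smooth functions off the origin *)

(** The values at the origin are junk. Since the complement of the origin is open, partial
    derivatives there depend only on the class of a function modulo this relation. *)
Definition eq_off (F G : point -> R) : Prop := forall p, p <> origin -> F p = G p.

Lemma set_coord_coord (i : axis) (p : point) : set_coord i p (coord i p) = p.
Proof. now destruct p as [[x y] z], i. Qed.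

Lemma continuous_coord (i : axis) (p : point) : continuous (coord i) p.
Proof.
  apply continuous_ext with
    (match i with Ax => fun p : point => fst (fst p)
     | Ay => fun p => snd (fst p) | Az => fun p => snd p end).
  { intros [[x y] z]; now destruct i. }
  destruct p as [[x y] z], i.
  - apply (continuous_comp (fst : point -> R * R) fst); apply continuous_fst.
  - apply (continuous_comp (fst : point -> R * R) snd);
      [apply continuous_fst | apply continuous_snd].
  - apply continuous_snd.
Qed.

Lemma continuous_point {U : UniformSpace} (a b c : U -> R) (u : U) :
  continuous a u -> continuous b u -> continuous c u ->
  continuous (fun v => (a v, b v, c v) : point) u.
Proof.
  intros Ha Hb Hc P [eps HP].
  pose proof (Ha _ (locally_ball (a u) eps)) as Ha'.
  pose proof (Hb _ (locally_ball (b u) eps)) as Hb'.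
  pose proof (Hc _ (locally_ball (c u) eps)) as Hc'.
  unfold filtermap in *.
  generalize (filter_and (F := locally u) _ _
    (filter_and (F := locally u) _ _ Ha' Hb') Hc').
  apply filter_imp. intros v [[H1 H2] H3]. apply HP. now repeat split.
Qed.

Lemma continuous_set_coord (i : axis) (p : point) (u : R) :
  continuous (set_coord i p) u.
Proof.
  destruct p as [[x y] z]; destruct i; apply continuous_point;
    solve [apply continuous_const | apply continuous_id].
Qed.

Lemma point_nonzero (p : point) : p <> origin -> exists i, coord i p <> 0.
Proof.
  destruct p as [[x y] z]; intro Hp.
  destruct (Req_dec x 0); [|now exists Ax]. destruct (Req_dec y 0); [|now exists Ay].
  destruct (Req_dec z 0); [|now exists Az]. subst. now contradiction Hp.
Qed.

Lemma locally_off_origin (p : point) :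
  p <> origin -> locally p (fun q => q <> origin).
Proof.
  intro Hp. destruct (point_nonzero p Hp) as [i Hi].
  generalize (continuous_coord i p (fun u => u <> 0)). intro H.
  assert (Hl : locally p (fun q => coord i q <> 0)).
  { apply H. apply (open_neq 0 (coord i p) Hi). }
  revert Hl. apply filter_imp. intros q Hq ->. apply Hq. now destruct i.
Qed.

Lemma locally_set_coord (i : axis) (p : point) :
  p <> origin -> locally (coord i p) (fun u => set_coord i p u <> origin).
Proof.
  intro Hp. apply (continuous_set_coord i p (coord i p) (fun q => q <> origin)).
  rewrite set_coord_coord. now apply locally_off_origin.
Qed.

Lemma partial_ext (i : axis) (F G : point -> R) :
  eq_off F G -> eq_off (partial i F) (partial i G).
Proof.
  intros E p Hp. apply Derive_ext_loc.
  generalize (locally_set_coord i p Hp). apply filter_imp. auto.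
Qed.

Lemma ex_partial_ext (i : axis) (F G : point -> R) (p : point) :
  eq_off F G -> p <> origin -> ex_partial i F p -> ex_partial i G p.
Proof.
  intros E Hp. apply ex_derive_ext_loc.
  generalize (locally_set_coord i p Hp). apply filter_imp. auto.
Qed.

Lemma continuous_eq_off (F G : point -> R) (p : point) :
  eq_off F G -> p <> origin -> continuous F p -> continuous G p.
Proof.
  intros E Hp. apply continuous_ext_loc.
  generalize (locally_off_origin p Hp). apply filter_imp. auto.
Qed.

Lemma partials_ext (l : list axis) (F G : point -> R) :
  eq_off F G -> eq_off (partials l F) (partials l G).
Proof. intro E. induction l as [|i l IH]; [exact E | exact (partial_ext i _ _ IH)]. Qed.

Definition differentiable_class (P : (point -> R) -> Prop) : Prop :=
  forall F, P F ->
    (forall p, p <> origin -> continuous F p) /\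
    forall i, (forall p, p <> origin -> ex_partial i F p) /\
      exists G, P G /\ eq_off (partial i F) G.

(* Coinduction principle for smoothness. *)
Lemma smooth_of_class (P : (point -> R) -> Prop) (F : point -> R) :
  differentiable_class P -> P F -> smooth_off_origin F.
Proof.
  intros HP HF l.
  assert (H : exists G, P G /\ eq_off (partials l F) G).
  { induction l as [|i l (G & HG & E)]; [now exists F|].
    destruct (HP G HG) as [_ Hd]. destruct (Hd i) as [_ (G' & HG' & E')].
    exists G'. split; [assumption|]. intros p Hp.
    rewrite <- E' by assumption. exact (partial_ext i _ _ E p Hp). }
  destruct H as (G & HG & E). destruct (HP G HG) as [Hc Hd].
  assert (E' : eq_off G (partials l F)) by (intros q Hq; now rewrite E).
  intros p Hp. split.
  - apply (continuous_eq_off G); auto.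
  - intro i. apply (ex_partial_ext i G); auto. now apply Hd.
Qed.

Lemma partials_app (l : list axis) (i : axis) (F : point -> R) :
  partials l (partial i F) = partials (l ++ i :: nil) F.
Proof. unfold partials. now rewrite fold_right_app. Qed.

Lemma smooth_partial (i : axis) (F : point -> R) :
  smooth_off_origin F -> smooth_off_origin (partial i F).
Proof. intros HF l p Hp. rewrite partials_app. now apply HF. Qed.

Lemma smooth_continuous (F : point -> R) (p : point) :
  smooth_off_origin F -> p <> origin -> continuous F p.
Proof. intros HF Hp. now apply (HF nil). Qed.

Lemma smooth_ex_partial (i : axis) (F : point -> R) (p : point) :
  smooth_off_origin F -> p <> origin -> ex_partial i F p.
Proof. intros HF Hp. now apply (HF nil). Qed.

Lemma smooth_eq_off (F G : point -> R) :
  eq_off F G -> smooth_off_origin F -> smooth_off_origin G.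
Proof.
  intros E HF l p Hp. pose proof (partials_ext l _ _ E) as El. split.
  - apply (continuous_eq_off (partials l F)); auto. now apply HF.
  - intro i. apply (ex_partial_ext i (partials l F)); auto. now apply HF.
Qed.

Definition rinv (p : point) : R := / norm3 p.

(** Closed under partials because the i-th partial of 1/r is -x_i (1/r)^3. As the smooth functions
    are among the generators, one use of the coinduction principle yields sums and products of
    arbitrary smooth functions, without expanding iterated partials of a product. *)
Inductive smooth_algebra : (point -> R) -> Prop :=
| sa_smooth F : smooth_off_origin F -> smooth_algebra F
| sa_const c : smooth_algebra (fun _ => c)
| sa_coord i : smooth_algebra (coord i)
| sa_rinv : smooth_algebra rinv
| sa_plus F G : smooth_algebra F -> smooth_algebra G ->
    smooth_algebra (fun p => F p + G p)
| sa_mult F G : smooth_algebra F -> smooth_algebra G ->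
    smooth_algebra (fun p => F p * G p).

Lemma norm3_pos (p : point) : p <> origin -> 0 < norm3 p.
Proof.
  intro Hp. destruct (point_nonzero p Hp) as [i Hi].
  destruct p as [[x y] z]. apply sqrt_lt_R0.
  destruct i; simpl in Hi; nra.
Qed.

Definition delta (i k : axis) : R :=
  match i, k with Ax, Ax | Ay, Ay | Az, Az => 1 | _, _ => 0 end.

Lemma is_derive_coord (i k : axis) (p : point) :
  is_derive (fun u => coord k (set_coord i p u)) (coord i p) (delta i k).
Proof.
  destruct p as [[x y] z]; destruct i, k; simpl;
    solve [apply @is_derive_id | apply @is_derive_const].
Qed.

Lemma partial_coord (i k : axis) (p : point) : partial i (coord k) p = delta i k.
Proof. apply is_derive_unique, is_derive_coord. Qed.

Lemma is_derive_rinv (i : axis) (p : point) : p <> origin ->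
  is_derive (fun u => rinv (set_coord i p u)) (coord i p)
    (- coord i p * rinv p * rinv p * rinv p).
Proof.
  intro Hp. pose proof (norm3_pos p Hp) as Hn.
  unfold rinv. destruct p as [[x y] z].
  assert (Hr : 0 < x ^ 2 + y ^ 2 + z ^ 2).
  { unfold norm3 in Hn. destruct (Rle_lt_dec (x ^ 2 + y ^ 2 + z ^ 2) 0) as [H|H]; [|exact H].
    rewrite (sqrt_neg_0 _ H) in Hn. lra. }
  pose proof (sqrt_sqrt _ (Rlt_le _ _ Hr)) as Hs.
  unfold norm3 in *.
  destruct i; simpl set_coord; simpl coord; cbv beta iota;
  (auto_derive; [repeat split; try (simpl in *; lra) |]);
  simpl in *; field; lra.
Qed.

Lemma continuous_rinv (p : point) : p <> origin -> continuous rinv p.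
Proof.
  intro Hp. pose proof (norm3_pos p Hp) as Hn.
  set (sq := fun q : point => coord Ax q ^ 2 + coord Ay q ^ 2 + coord Az q ^ 2).
  apply continuous_ext with (fun q => / sqrt (sq q)).
  { now intros [[x y] z]. }
  assert (Hs : 0 < sq p).
  { destruct (point_nonzero p Hp) as [i Hi]. unfold sq. destruct i; nra. }
  apply (continuous_comp sq (fun u => / sqrt u)).
  - repeat apply @continuous_plus; simpl;
      repeat apply @continuous_mult; try apply continuous_coord; apply continuous_const.
  - apply (ex_derive_continuous (fun u => / sqrt u)). auto_derive.
    pose proof (sqrt_lt_R0 _ Hs). split; [assumption|]. split; [lra|trivial].
Qed.

Lemma smooth_algebra_class : differentiable_class smooth_algebra.
Proof.
  intros F HF. induction HF as [F HF|c|k| |F G HF [cF dF] HG [cG dG]|F G HF [cF dF] HG [cG dG]].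
  - split; [intros; now apply smooth_continuous|]. intro i.
    split; [intros; now apply smooth_ex_partial|].
    exists (partial i F). split; [|now intros p Hp].
    apply sa_smooth. now apply smooth_partial.
  - split; [intros; apply continuous_const|]. intro i.
    split; [intros; exact (ex_derive_const c _)|].
    exists (fun _ => 0). split; [apply sa_const|].
    intros p Hp. exact (Derive_const c _).
  - split; [intros; apply continuous_coord|]. intro i.
    split; [intros p Hp; eexists; apply is_derive_coord|].
    exists (fun _ => delta i k). split; [apply sa_const|].
    intros p Hp. apply partial_coord.
  - split; [apply continuous_rinv|]. intro i.
    split; [intros p Hp; eexists; now apply is_derive_rinv|].
    exists (fun p => (-1) * coord i p * rinv p * rinv p * rinv p). split.
    + repeat apply sa_mult; solve [apply sa_const | apply sa_coord | apply sa_rinv].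
    + intros p Hp. cbv beta. replace (-1 * coord i p) with (- coord i p) by ring.
      apply is_derive_unique. now apply is_derive_rinv.
  - split; [intros; apply @continuous_plus; auto|]. intro i.
    destruct (dF i) as [eF (F' & HF' & EF)], (dG i) as [eG (G' & HG' & EG)].
    split; [intros; apply @ex_derive_plus; [apply eF | apply eG]; assumption|].
    exists (fun p => F' p + G' p). split; [now apply sa_plus|].
    intros p Hp. rewrite <- EF, <- EG by assumption.
    apply Derive_plus; [apply eF | apply eG]; assumption.
  - split; [intros; apply @continuous_mult; auto|]. intro i.
    destruct (dF i) as [eF (F' & HF' & EF)], (dG i) as [eG (G' & HG' & EG)].
    split; [intros; apply ex_derive_mult; [apply eF | apply eG]; assumption|].
    exists (fun p => F' p * G p + F p * G' p). split.
    + apply sa_plus; now apply sa_mult.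
    + intros p Hp. rewrite <- EF, <- EG by assumption.
      unfold partial. rewrite Derive_mult by (apply eF || apply eG; assumption).
      now rewrite set_coord_coord.
Qed.

Lemma smooth_in_algebra (F : point -> R) : smooth_algebra F -> smooth_off_origin F.
Proof. exact (smooth_of_class _ F smooth_algebra_class). Qed.

Lemma smooth_const (c : R) : smooth_off_origin (fun _ => c).
Proof. apply smooth_in_algebra, sa_const. Qed.

Lemma smooth_coord (i : axis) : smooth_off_origin (coord i).
Proof. apply smooth_in_algebra, sa_coord. Qed.

Lemma smooth_rinv : smooth_off_origin rinv.
Proof. apply smooth_in_algebra, sa_rinv. Qed.

Lemma smooth_plus (F G : point -> R) : smooth_off_origin F -> smooth_off_origin G ->
  smooth_off_origin (fun p => F p + G p).
Proof. intros. apply smooth_in_algebra, sa_plus; now apply sa_smooth. Qed.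

Lemma smooth_mult (F G : point -> R) : smooth_off_origin F -> smooth_off_origin G ->
  smooth_off_origin (fun p => F p * G p).
Proof. intros. apply smooth_in_algebra, sa_mult; now apply sa_smooth. Qed.

Lemma smooth_opp (F : point -> R) : smooth_off_origin F ->
  smooth_off_origin (fun p => - F p).
Proof.
  intro HF. apply smooth_eq_off with (fun p => (-1) * F p); [intros p _; ring|].
  apply smooth_mult; [apply smooth_const | assumption].
Qed.

Lemma smooth_minus (F G : point -> R) : smooth_off_origin F -> smooth_off_origin G ->
  smooth_off_origin (fun p => F p - G p).
Proof. intros. apply smooth_plus; [|apply smooth_opp]; assumption. Qed.

Section PartialRules.
Variables (i : axis) (F G : point -> R) (p : point).
Hypothesis (HF : smooth_off_origin F) (HG : smooth_off_origin G) (Hp : p <> origin).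

Lemma partial_plus : partial i (fun q => F q + G q) p = partial i F p + partial i G p.
Proof. apply Derive_plus; now apply smooth_ex_partial. Qed.

Lemma partial_minus : partial i (fun q => F q - G q) p = partial i F p - partial i G p.
Proof. apply Derive_minus; now apply smooth_ex_partial. Qed.

Lemma partial_scal (c : R) : partial i (fun q => c * F q) p = c * partial i F p.
Proof. apply Derive_scal. Qed.

Lemma partial_opp : partial i (fun q => - F q) p = - partial i F p.
Proof. apply Derive_opp. Qed.

Lemma partial_mult :
  partial i (fun q => F q * G q) p = partial i F p * G p + F p * partial i G p.
Proof.
  unfold partial. rewrite Derive_mult by now apply smooth_ex_partial.
  now rewrite set_coord_coord.
Qed.
End PartialRules.

(** Schwarz's theorem in the plane through [p] parallel to the two axes, which [q] parametrizes; the
    assertions [Di], [Dk], [Ei], [Ek] translate between derivatives in that plane and partials in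
    space. *)
Lemma partial_comm (i k : axis) (F : point -> R) (p : point) :
  smooth_off_origin F -> p <> origin ->
  partial i (partial k F) p = partial k (partial i F) p.
Proof.
  intros HF Hp.
  destruct (classic (i = k)) as [->|Hik]; [reflexivity|].
  set (q := fun u v => set_coord k (set_coord i p u) v).
  assert (Hqi : forall u v z, set_coord i (q u v) z = q z v /\ coord i (q u v) = u).
  { intros u v z. unfold q. destruct p as [[x1 x2] x3].
    destruct i, k; simpl; intuition congruence. }
  assert (Hqk : forall u v z, set_coord k (q u v) z = q u z /\ coord k (q u v) = v).
  { intros u v z. unfold q. destruct p as [[x1 x2] x3].
    destruct i, k; simpl; intuition congruence. }
  assert (Hq0 : q (coord i p) (coord k p) = p).
  { unfold q. now rewrite !set_coord_coord. }
  assert (Di : forall (G : point -> R) u v, Derive (fun z => G (q z v)) u = partial i G (q u v)).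
  { intros G u v. unfold partial. rewrite (proj2 (Hqi u v 0)).
    apply Derive_ext. intro t. now rewrite (proj1 (Hqi u v t)). }
  assert (Dk : forall (G : point -> R) u v, Derive (fun z => G (q u z)) v = partial k G (q u v)).
  { intros G u v. unfold partial. rewrite (proj2 (Hqk u v 0)).
    apply Derive_ext. intro t. now rewrite (proj1 (Hqk u v t)). }
  assert (Ei : forall (G : point -> R) u v, ex_partial i G (q u v) -> ex_derive (fun z => G (q z v)) u).
  { intros G u v. unfold ex_partial. rewrite (proj2 (Hqi u v 0)).
    apply ex_derive_ext. intro t. now rewrite (proj1 (Hqi u v t)). }
  assert (Ek : forall (G : point -> R) u v, ex_partial k G (q u v) -> ex_derive (fun z => G (q u z)) v).
  { intros G u v. unfold ex_partial. rewrite (proj2 (Hqk u v 0)).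
    apply ex_derive_ext. intro t. now rewrite (proj1 (Hqk u v t)). }
  assert (Cq : continuous (fun w : R * R => q (fst w) (snd w)) (coord i p, coord k p)).
  { assert (Cf : continuous (fun w : R * R => fst w) (coord i p, coord k p)) by apply continuous_fst.
    assert (Cs : continuous (fun w : R * R => snd w) (coord i p, coord k p)) by apply continuous_snd.
    unfold q. destruct p as [[x1 x2] x3].
    destruct i, k; apply continuous_point; try assumption; apply continuous_const. }
  assert (Hloc : locally_2d (fun u v => q u v <> origin) (coord i p) (coord k p)).
  { apply locally_2d_locally. apply (Cq (fun w => w <> origin)). simpl.
    rewrite Hq0. now apply locally_off_origin. }
  assert (Cont : forall G, smooth_off_origin G ->
    continuity_2d_pt (fun u v => G (q u v)) (coord i p) (coord k p)).
  { intros G HG. apply continuity_2d_pt_filterlim.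
    apply (continuous_comp (fun w : R * R => q (fst w) (snd w)) G _ Cq). simpl.
    rewrite Hq0. now apply smooth_continuous. }
  pose proof (smooth_partial i F HF) as HFi. pose proof (smooth_partial k F HF) as HFk.
  assert (Eik : forall u v, Derive (fun z => Derive (fun t => F (q z t)) v) u
     = partial i (partial k F) (q u v)).
  { intros u v. rewrite <- Di. apply Derive_ext. intro t. apply Dk. }
  assert (Eki : forall u v, Derive (fun z => Derive (fun t => F (q t z)) u) v
     = partial k (partial i F) (q u v)).
  { intros u v. rewrite <- Dk. apply Derive_ext. intro t. apply Di. }
  assert (E : partial i (partial k F) (q (coord i p) (coord k p))
    = partial k (partial i F) (q (coord i p) (coord k p))); [|now rewrite Hq0 in E].
  rewrite <- Eik, <- Eki.
  apply (Schwarz (fun u v => F (q u v))).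
  - revert Hloc. apply locally_2d_impl, locally_2d_forall. intros u v Huv.
    repeat split.
    + now apply Ei, smooth_ex_partial.
    + now apply Ek, smooth_ex_partial.
    + apply ex_derive_ext with (fun z => partial k F (q z v)).
      { intro t. symmetry. apply Dk. }
      now apply Ei, smooth_ex_partial.
    + apply ex_derive_ext with (fun z => partial i F (q u z)).
      { intro t. symmetry. apply Di. }
      now apply Ek, smooth_ex_partial.
  - apply continuity_2d_pt_ext with (fun u v => partial i (partial k F) (q u v)).
    { intros u v. now rewrite <- Eik. }
    now apply Cont, smooth_partial.
  - apply continuity_2d_pt_ext with (fun u v => partial k (partial i F) (q u v)).
    { intros u v. now rewrite <- Eki. }
    now apply Cont, smooth_partial.
Qed.

(** Sets one coordinate in motion: [P s v] has i-th coordinate [s] while the others follow the time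
    [v], and [d] is the derivative with the i-th coordinate frozen at [u t]. Three uses give the
    chain rule, starting from a constant; hence the final [+ 0] there. *)
Lemma chain_rule_step (F : point -> R) (i : axis) (P : R -> R -> point)
    (u : R -> R) (t u' d : R) :
  smooth_off_origin F ->
  (forall s v z, set_coord i (P s v) z = P z v) ->
  (forall s v, coord i (P s v) = s) ->
  P (u t) t <> origin ->
  continuous (fun w : R * R => P (fst w) (snd w)) (u t, t) ->
  is_derive u t u' ->
  is_derive (fun s => F (P (u t) s)) t d ->
  is_derive (fun s => F (P (u s) s)) t (partial i F (P (u t) t) * u' + d).
Proof.
  intros HF Hset Hcoord HPt HPc Hu Hd.
  assert (Di : forall s v, P s v <> origin ->
    is_derive (fun z => F (P z v)) s (partial i F (P s v))).
  { intros s v Hsv. pose proof (smooth_ex_partial i F _ HF Hsv) as D.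
    apply Derive_correct in D. unfold partial. rewrite Hcoord in *.
    revert D. apply is_derive_ext. intro z. now rewrite Hset. }
  assert (Hdiff : differentiable_pt_lim (fun s v => F (P s v)) (u t) t
    (partial i F (P (u t) t)) d).
  { apply filterdiff_differentiable_pt_lim.
    apply (is_derive_filterdiff (fun s v => F (P s v)) (u t) t
      (fun s v => partial i F (P s v)) d).
    - pose proof (HPc _ (locally_off_origin _ HPt)) as HL. unfold filtermap in HL.
      revert HL. apply filter_imp.
      intros w Hw. now apply Di.
    - exact Hd.
    - apply (continuous_comp (fun w : R * R => P (fst w) (snd w)) (partial i F) _ HPc).
      apply smooth_continuous; [now apply smooth_partial | exact HPt]. }
  apply is_derive_Reals.
  replace (partial i F (P (u t) t) * u' + d)
    with (partial i F (P (u t) t) * u' + d * 1) by ring.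
  apply (derivable_pt_lim_comp_2d (fun s v => F (P s v)) u (fun s => s) t _ _ _ _ Hdiff).
  - now apply is_derive_Reals.
  - apply is_derive_Reals, @is_derive_id.
Qed.

Lemma chain_rule (F : point -> R) (a b c : R -> R) (t a' b' c' : R) :
  smooth_off_origin F -> (a t, b t, c t) <> origin ->
  is_derive a t a' -> is_derive b t b' -> is_derive c t c' ->
  is_derive (fun s => F (a s, b s, c s)) t
    (partial Ax F (a t, b t, c t) * a' + (partial Ay F (a t, b t, c t) * b'
     + (partial Az F (a t, b t, c t) * c' + 0))).
Proof.
  intros HF Hp Ha Hb Hc.
  assert (cont : forall (f : R -> R) (f' : R), is_derive f t f' ->
    forall s, continuous (fun w : R * R => f (snd w)) (s, t)).
  { intros f f' Hf s. apply (continuous_comp snd f); [apply continuous_snd|].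
    apply (ex_derive_continuous f). now exists f'. }
  assert (cfst : forall s, continuous (fun w : R * R => fst w) (s, t)).
  { intro s. apply continuous_fst. }
  apply (chain_rule_step F Ax (fun s v => (s, b v, c v)) a); try easy.
  { apply continuous_point; eauto. }
  apply (chain_rule_step F Ay (fun s v => (a t, s, c v)) b); try easy.
  { apply continuous_point; eauto. apply continuous_const. }
  apply (chain_rule_step F Az (fun s v => (a t, b t, s)) c); try easy.
  { apply continuous_point; eauto; apply continuous_const. }
  exact (is_derive_const (F (a t, b t, c t)) t).
Qed.

(** * Rotation vector fields, the Euler field and the Casimir operator *)

Definition angular (i : axis) (F : point -> R) (p : point) : R :=
  match i with
  | Ax => coord Ay p * partial Az F p - coord Az p * partial Ay F p
  | Ay => coord Az p * partial Ax F p - coord Ax p * partial Az F p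
  | Az => coord Ax p * partial Ay F p - coord Ay p * partial Ax F p
  end.

Definition euler (F : point -> R) (p : point) : R :=
  coord Ax p * partial Ax F p + coord Ay p * partial Ay F p + coord Az p * partial Az F p.

Definition casimir (F : point -> R) (p : point) : R :=
  angular Ax (angular Ax F) p + angular Ay (angular Ay F) p + angular Az (angular Az F) p.

Lemma angular_ext (i : axis) (F G : point -> R) : eq_off F G -> eq_off (angular i F) (angular i G).
Proof.
  intros E p Hp. destruct i; simpl;
    now rewrite !(partial_ext _ _ _ E p Hp).
Qed.

Lemma smooth_angular (i : axis) (F : point -> R) :
  smooth_off_origin F -> smooth_off_origin (angular i F).
Proof.
  intro HF; destruct i; apply smooth_minus; apply smooth_mult;
    auto using smooth_coord, smooth_partial.
Qed.

Lemma partial_coord_mult (i k : axis) (F : point -> R) (p : point) :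
  smooth_off_origin F -> p <> origin ->
  partial i (fun q => coord k q * F q) p = delta i k * F p + coord k p * partial i F p.
Proof.
  intros HF Hp. rewrite partial_mult; auto using smooth_coord.
  now rewrite partial_coord.
Qed.

Lemma partial_angular (k i : axis) (F : point -> R) (p : point) :
  smooth_off_origin F -> p <> origin ->
  partial k (angular i F) p =
  match i with
  | Ax => (delta k Ay * partial Az F p + coord Ay p * partial k (partial Az F) p)
          - (delta k Az * partial Ay F p + coord Az p * partial k (partial Ay F) p)
  | Ay => (delta k Az * partial Ax F p + coord Az p * partial k (partial Ax F) p)
          - (delta k Ax * partial Az F p + coord Ax p * partial k (partial Az F) p)
  | Az => (delta k Ax * partial Ay F p + coord Ax p * partial k (partial Ay F) p)
          - (delta k Ay * partial Ax F p + coord Ay p * partial k (partial Ax F) p)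
  end.
Proof.
  intros HF Hp. destruct i; unfold angular;
    rewrite partial_minus by auto using smooth_mult, smooth_coord, smooth_partial;
    now rewrite !partial_coord_mult by auto using smooth_partial.
Qed.

(** Rotations are differentiated in the form F(Rp), which reverses the order of composition; this is
    the origin of the minus signs. *)
Lemma angular_comm (F : point -> R) (p : point) : smooth_off_origin F -> p <> origin ->
  angular Ax (angular Ay F) p - angular Ay (angular Ax F) p = - angular Az F p /\
  angular Ay (angular Az F) p - angular Az (angular Ay F) p = - angular Ax F p /\
  angular Az (angular Ax F) p - angular Ax (angular Az F) p = - angular Ay F p.
Proof.
  intros HF Hp. unfold angular at 1 3 5 6 8 10 11 13 15.
  rewrite !partial_angular by assumption.
  rewrite (partial_comm Ay Ax), (partial_comm Az Ax), (partial_comm Az Ay) by assumption.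
  unfold angular, delta. repeat split; ring.
Qed.

(** In general the Casimir operator is r^2 times the Laplacian minus E(E + 1), where E is the Euler
    field. Here EF = 0; the identity E(EF) = 0 enters as the sum of x_k times the k-th partial of
    EF. *)
Lemma casimir_laplacian (F : point -> R) (p : point) :
  smooth_off_origin F -> p <> origin -> eq_off (euler F) (fun _ => 0) ->
  casimir F p = (coord Ax p ^ 2 + coord Ay p ^ 2 + coord Az p ^ 2) * laplacian3 F p.
Proof.
  intros HF Hp HE.
  assert (E1 : forall k, partial k (euler F) p = 0).
  { intro k. rewrite (partial_ext k _ _ HE p Hp). exact (Derive_const 0 _). }
  assert (E2 : forall k, partial k (euler F) p =
    (delta k Ax * partial Ax F p + coord Ax p * partial k (partial Ax F) p)
    + (delta k Ay * partial Ay F p + coord Ay p * partial k (partial Ay F) p)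
    + (delta k Az * partial Az F p + coord Az p * partial k (partial Az F) p)).
  { intro k. unfold euler.
    rewrite !partial_plus by auto 6 using smooth_plus, smooth_mult, smooth_coord, smooth_partial.
    now rewrite !partial_coord_mult by auto using smooth_partial. }
  pose proof (HE p Hp) as E0. cbv beta in E0. unfold euler in E0.
  pose proof (E1 Ax) as Ex. pose proof (E1 Ay) as Ey. pose proof (E1 Az) as Ez.
  rewrite E2 in Ex, Ey, Ez.
  unfold casimir, laplacian3. unfold angular at 1 3 5.
  rewrite !partial_angular by assumption.
  rewrite (partial_comm Ay Ax), (partial_comm Az Ax), (partial_comm Az Ay) in * by assumption.
  apply (f_equal (Rmult (coord Ax p))) in Ex.
  apply (f_equal (Rmult (coord Ay p))) in Ey.
  apply (f_equal (Rmult (coord Az p))) in Ez.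
  unfold delta in *. unfold angular. lra.
Qed.

(** * Infinitesimal rotations and harmonics *)

Definition scale (l : R) (p : point) : point :=
  (l * coord Ax p, l * coord Ay p, l * coord Az p).

Definition homogeneous (F : point -> R) : Prop :=
  forall l p, 0 < l -> p <> origin -> F (scale l p) = F p.

Lemma coord_scale (l : R) (i : axis) (p : point) : coord i (scale l p) = l * coord i p.
Proof. now destruct p as [[x y] z], i. Qed.

Lemma scale_scale (k l : R) (p : point) : scale k (scale l p) = scale (k * l) p.
Proof. unfold scale. simpl. now rewrite !Rmult_assoc. Qed.

Lemma scale_1 (p : point) : scale 1 p = p.
Proof. destruct p as [[x y] z]. unfold scale. simpl. now rewrite !Rmult_1_l. Qed.

Lemma scale_off_origin (l : R) (p : point) : 0 < l -> p <> origin -> scale l p <> origin.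
Proof.
  intros Hl Hp E. apply Hp.
  rewrite <- (scale_1 p), <- (Rinv_l l), <- scale_scale, E by lra.
  unfold scale, origin. simpl. now rewrite !Rmult_0_r.
Qed.

Lemma norm3_scale (l : R) (p : point) : 0 < l -> norm3 (scale l p) = l * norm3 p.
Proof.
  intro Hl. destruct p as [[x y] z]. simpl.
  transitivity (sqrt (l * l) * sqrt (x ^ 2 + y ^ 2 + z ^ 2)).
  - rewrite <- sqrt_mult by nra. f_equal. ring.
  - now rewrite sqrt_square by lra.
Qed.

Lemma extend0_scale (f : point -> R) (p : point) : extend0 f p = f (scale (/ norm3 p) p).
Proof.
  destruct p as [[x y] z]. unfold extend0, scale, Rdiv. simpl.
  now rewrite !(Rmult_comm (/ _)).
Qed.

Lemma scale_inv_norm3 (p : point) : p <> origin ->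
  S2 (scale (/ norm3 p) p) /\ p = scale (norm3 p) (scale (/ norm3 p) p).
Proof.
  intro Hp. pose proof (norm3_pos p Hp) as Hn. split.
  - unfold S2. rewrite norm3_scale by now apply Rinv_0_lt_compat. apply Rinv_l; lra.
  - rewrite scale_scale, Rinv_r, scale_1; lra || reflexivity.
Qed.

Lemma S2_off_origin (p : point) : S2 p -> p <> origin.
Proof.
  intros Hp ->. unfold S2, norm3, origin in Hp.
  replace (0 ^ 2 + 0 ^ 2 + 0 ^ 2) with 0 in Hp by ring. rewrite sqrt_0 in Hp. lra.
Qed.

Lemma extend0_S2 (f : point -> R) (p : point) : S2 p -> extend0 f p = f p.
Proof. intro Hp. now rewrite extend0_scale, Hp, Rinv_1, scale_1. Qed.

Lemma homogeneous_extend0 (f : point -> R) : homogeneous (extend0 f).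
Proof.
  intros l p Hl Hp. pose proof (norm3_pos p Hp) as Hn.
  rewrite !extend0_scale, norm3_scale, scale_scale by assumption.
  do 2 f_equal. field. lra.
Qed.

Lemma homogeneous_S2 (F : point -> R) (p : point) : homogeneous F -> p <> origin ->
  F p = F (scale (/ norm3 p) p).
Proof.
  intros HF Hp. rewrite HF; auto using Rinv_0_lt_compat, norm3_pos.
Qed.

Lemma homogeneous_eq_off (F G : point -> R) : homogeneous F -> homogeneous G ->
  (forall p, S2 p -> F p = G p) -> eq_off F G.
Proof.
  intros HF HG E p Hp. rewrite (homogeneous_S2 F), (homogeneous_S2 G) by assumption.
  apply E. now apply scale_inv_norm3.
Qed.

Lemma extend0_homogeneous (F : point -> R) : homogeneous F -> eq_off (extend0 F) F.
Proof.
  intro HF. apply homogeneous_eq_off; auto using homogeneous_extend0, extend0_S2.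
Qed.

Lemma partial_scale (i : axis) (F : point -> R) (l : R) (p : point) :
  smooth_off_origin F -> homogeneous F -> 0 < l -> p <> origin ->
  partial i F (scale l p) = / l * partial i F p.
Proof.
  intros HF HH Hl Hp.
  assert (D : is_derive (fun u => F (set_coord i (scale l p) u)) (l * coord i p)
    (partial i F (scale l p))).
  { rewrite <- coord_scale.
    exact (Derive_correct _ _ (smooth_ex_partial i F _ HF (scale_off_origin l p Hl Hp))). }
  assert (D' : is_derive (fun u => F (set_coord i p u)) (coord i p)
    (l * partial i F (scale l p))).
  { apply is_derive_ext_loc with (fun u => F (set_coord i (scale l p) (l * u))).
    - generalize (locally_set_coord i p Hp). apply filter_imp. intros u Hu.
      rewrite <- (HH l _ Hl Hu). f_equal.
      destruct p as [[x y] z], i; reflexivity.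
    - apply (is_derive_comp (fun u => F (set_coord i (scale l p) u)) (fun u => l * u));
        [exact D|].
      auto_derive; [trivial|ring]. }
  assert (E : partial i F p = l * partial i F (scale l p)) by exact (is_derive_unique _ _ _ D').
  rewrite E. field. lra.
Qed.

Lemma homogeneous_angular (i : axis) (F : point -> R) :
  smooth_off_origin F -> homogeneous F -> homogeneous (angular i F).
Proof.
  intros HF HH l p Hl Hp. unfold angular.
  destruct i; rewrite !partial_scale, !coord_scale by assumption; field; lra.
Qed.

Lemma euler_homogeneous (F : point -> R) :
  smooth_off_origin F -> homogeneous F -> eq_off (euler F) (fun _ => 0).
Proof.
  intros HF HH p Hp.
  assert (D0 : is_derive (fun s => F (scale s p)) 1 0).
  { apply is_derive_ext_loc with (fun _ => F p); [|exact (is_derive_const (F p) 1)].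
    assert (H1 : 1 > 0) by lra.
    generalize (open_gt 0 1 H1). apply filter_imp. intros s Hs. now rewrite HH. }
  assert (D : forall i, is_derive (fun s => s * coord i p) 1 (coord i p)).
  { intro i. auto_derive; [trivial|ring]. }
  pose proof (chain_rule F (fun s => s * coord Ax p) (fun s => s * coord Ay p)
    (fun s => s * coord Az p) 1 (coord Ax p) (coord Ay p) (coord Az p) HF) as D1.
  cbv beta in D1. fold (scale 1 p) in D1. rewrite scale_1 in D1.
  specialize (D1 Hp (D Ax) (D Ay) (D Az)).
  apply is_derive_unique in D0. apply is_derive_unique in D1.
  unfold scale in D0. rewrite D0 in D1. unfold euler. lra.
Qed.

(** The Casimir operator preserves degree 0, while the Laplacian lowers the degree by 2. In this
    form the eigenvalue equation is constant along rays and passes from the sphere to all points off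
    the origin. *)
Definition harmonic (mu : R) (F : point -> R) : Prop :=
  smooth_off_origin F /\ homogeneous F /\ eq_off (casimir F) (fun p => - mu * F p).

Lemma norm3_sqr (p : point) :
  coord Ax p ^ 2 + coord Ay p ^ 2 + coord Az p ^ 2 = norm3 p ^ 2.
Proof.
  destruct p as [[x y] z]. unfold norm3. simpl coord. rewrite pow2_sqrt; nra.
Qed.

Lemma eigenspace_harmonic (mu : R) (f : point -> R) :
  eigenspace mu f -> harmonic mu (extend0 f).
Proof.
  intros [Hs He]. assert (HH := homogeneous_extend0 f).
  split; [exact Hs|]. split; [exact HH|].
  apply homogeneous_eq_off.
  - intros l p Hl Hp. unfold casimir.
    rewrite !homogeneous_angular; auto using smooth_angular, homogeneous_angular.
  - intros l p Hl Hp. now rewrite HH.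
  - intros p Hp. pose proof (S2_off_origin p Hp) as Hp0.
    rewrite casimir_laplacian, norm3_sqr, Hp, extend0_S2; auto using euler_homogeneous.
    pose proof (He p Hp) as E. unfold laplacian_S2 in E. lra.
Qed.

Lemma harmonic_eigenspace (mu : R) (F : point -> R) : harmonic mu F -> eigenspace mu F.
Proof.
  intros (Hs & HH & HC). pose proof (extend0_homogeneous F HH) as E.
  assert (E' : eq_off F (extend0 F)) by (intros q Hq; now rewrite E).
  split.
  - now apply (smooth_eq_off F).
  - intros p Hp. pose proof (S2_off_origin p Hp) as Hp0.
    pose proof (HC p Hp0) as H.
    rewrite casimir_laplacian, norm3_sqr, Hp in H; auto using euler_homogeneous.
    unfold laplacian_S2, laplacian3.
    rewrite !(partial_ext _ _ _ (partial_ext _ _ _ E) p Hp0).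
    unfold laplacian3 in H. lra.
Qed.

Lemma angular_scal (i : axis) (c : R) (F : point -> R) (p : point) :
  angular i (fun q => c * F q) p = c * angular i F p.
Proof. destruct i; simpl; rewrite !partial_scal; ring. Qed.

Lemma angular_plus (i : axis) (F G : point -> R) (p : point) :
  smooth_off_origin F -> smooth_off_origin G -> p <> origin ->
  angular i (fun q => F q + G q) p = angular i F p + angular i G p.
Proof. intros. destruct i; simpl; rewrite !partial_plus by assumption; ring. Qed.

Lemma angular_opp (i : axis) (F : point -> R) (p : point) :
  angular i (fun q => - F q) p = - angular i F p.
Proof. destruct i; simpl; rewrite !partial_opp; ring. Qed.

Lemma angular_minus (i : axis) (F G : point -> R) (p : point) :
  smooth_off_origin F -> smooth_off_origin G -> p <> origin ->
  angular i (fun q => F q - G q) p = angular i F p - angular i G p.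
Proof. intros. destruct i; simpl; rewrite !partial_minus by assumption; ring. Qed.

Lemma angular_mult (i : axis) (F G : point -> R) (p : point) :
  smooth_off_origin F -> smooth_off_origin G -> p <> origin ->
  angular i (fun q => F q * G q) p = angular i F p * G p + F p * angular i G p.
Proof. intros. destruct i; simpl; rewrite !partial_mult by assumption; ring. Qed.

Lemma angular_casimir (i : axis) (F : point -> R) : smooth_off_origin F ->
  eq_off (casimir (angular i F)) (angular i (casimir F)).
Proof.
  intros HF p Hp.
  assert (Hsm : forall k, smooth_off_origin (angular k F)) by auto using smooth_angular.
  assert (Hsm2 : forall k l, smooth_off_origin (angular k (angular l F))) by auto using smooth_angular.
  (* Words of length three in the rotations are reordered in two places: [T] swaps the inner pair,
     the instances of [angular_comm] at rotated functions swap the outer pair. The Casimir identity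
     is a linear consequence. *)
  assert (T : forall k,
    angular k (angular Ax (angular Ay F)) p =
      angular k (angular Ay (angular Ax F)) p - angular k (angular Az F) p /\
    angular k (angular Ay (angular Az F)) p =
      angular k (angular Az (angular Ay F)) p - angular k (angular Ax F) p /\
    angular k (angular Az (angular Ax F)) p =
      angular k (angular Ax (angular Az F)) p - angular k (angular Ay F) p).
  { intro k. rewrite <- !angular_minus by auto.
    split; [|split]; apply angular_ext; trivial; intros q Hq;
      destruct (angular_comm F q HF Hq) as (c1 & c2 & c3); lra. }
  assert (E : angular i (casimir F) p = angular i (angular Ax (angular Ax F)) p
    + angular i (angular Ay (angular Ay F)) p + angular i (angular Az (angular Az F)) p).
  { unfold casimir. rewrite !angular_plus; auto using smooth_plus. }
  rewrite E. unfold casimir.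
  pose proof (T Ax) as (a1 & a2 & a3). pose proof (T Ay) as (b1 & b2 & b3).
  pose proof (T Az) as (c1 & c2 & c3).
  pose proof (angular_comm (angular Ax F) p (Hsm Ax) Hp) as (d1 & d2 & d3).
  pose proof (angular_comm (angular Ay F) p (Hsm Ay) Hp) as (e1 & e2 & e3).
  pose proof (angular_comm (angular Az F) p (Hsm Az) Hp) as (f1 & f2 & f3).
  destruct i; lra.
Qed.

Lemma harmonic_angular (mu : R) (i : axis) (F : point -> R) :
  harmonic mu F -> harmonic mu (angular i F).
Proof.
  intros (Hs & HH & HC). split; [|split].
  - now apply smooth_angular.
  - now apply homogeneous_angular.
  - intros p Hp. rewrite angular_casimir, (angular_ext i _ _ HC p Hp), angular_scal by assumption.
    reflexivity.
Qed.

(* [F1 + i F2] is annihilated by the raising operator and has weight [w]. *)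
Definition highest_weight (w : R) (F1 F2 : point -> R) : Prop :=
  eq_off (angular Az F1) (fun p => - w * F2 p) /\ eq_off (angular Az F2) (fun p => w * F1 p) /\
  eq_off (angular Ay F1) (fun p => - angular Ax F2 p) /\ eq_off (angular Ay F2) (angular Ax F1).

(** The raising equations turn A^2 + B^2 on [F1] into the commutator [A, B] on [F2], that is, -C F2
    = -w F1; the remaining C^2 contributes -w^2 F1. *)
Lemma highest_weight_casimir (w : R) (F1 F2 : point -> R) :
  smooth_off_origin F1 -> smooth_off_origin F2 -> highest_weight w F1 F2 ->
  eq_off (casimir F1) (fun p => - (w * (w + 1)) * F1 p).
Proof.
  intros S1 S2 (C1 & C2 & B1 & B2) p Hp. unfold casimir.
  assert (E1 : angular Ax (angular Ax F1) p = angular Ax (angular Ay F2) p).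
  { apply angular_ext; trivial. intros q Hq. now rewrite B2. }
  assert (E2 : angular Ay (angular Ay F1) p = - angular Ay (angular Ax F2) p).
  { rewrite (angular_ext _ _ _ B1 p Hp). apply angular_opp. }
  assert (E3 : angular Az (angular Az F1) p = - w * angular Az F2 p).
  { rewrite (angular_ext _ _ _ C1 p Hp). apply angular_scal. }
  rewrite E1, E2, E3. pose proof (angular_comm F2 p S2 Hp) as (c & _ & _).
  rewrite C2 in * by assumption. lra.
Qed.

(* On functions that are constant along rays the gradient is determined by the
   three rotations. *)
Lemma partial_z_angular (F : point -> R) (p : point) :
  smooth_off_origin F -> homogeneous F -> p <> origin ->
  norm3 p ^ 2 * partial Az F p = coord Ay p * angular Ax F p - coord Ax p * angular Ay F p.
Proof.
  intros HF HH Hp. pose proof (euler_homogeneous F HF HH p Hp) as E.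
  apply (f_equal (Rmult (coord Az p))) in E.
  rewrite <- norm3_sqr. unfold euler in E. unfold angular. lra.
Qed.

Lemma radial_angular (F : point -> R) (p : point) :
  coord Ax p * angular Ax F p + coord Ay p * angular Ay F p + coord Az p * angular Az F p = 0.
Proof. unfold angular. ring. Qed.

(** The raising equations identify the right side of [partial_z_angular] for one component with part
    of [radial_angular] for the other. So the system uncouples into one linear equation per
    component along vertical lines. *)
Lemma highest_weight_partial_z (w : R) (F1 F2 : point -> R) :
  smooth_off_origin F1 -> smooth_off_origin F2 ->
  homogeneous F1 -> homogeneous F2 -> highest_weight w F1 F2 ->
  forall p, p <> origin ->
    norm3 p ^ 2 * partial Az F1 p = - w * coord Az p * F1 p /\
    norm3 p ^ 2 * partial Az F2 p = - w * coord Az p * F2 p.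
Proof.
  intros S1 S2 H1 H2 (C1 & C2 & B1 & B2) p Hp.
  rewrite !partial_z_angular, B1, B2 by assumption.
  pose proof (radial_angular F1 p) as R1. pose proof (radial_angular F2 p) as R2.
  rewrite C1, B1 in R1 by assumption. rewrite C2, B2 in R2 by assumption. lra.
Qed.

Lemma zero_derivative_constant (f : R -> R) (s t : R) :
  (forall u, is_derive f u 0) -> f s = f t.
Proof.
  intro D. destruct (Rtotal_order s t) as [H|[->|H]]; [|reflexivity|].
  - apply (eq_is_derive f s t); auto.
  - symmetry. apply (eq_is_derive f t s); auto.
Qed.

(** Over a point of the unit circle r^2 = 1 + t^2, and the equation becomes f' = -w t f / (1 + t^2),
    with integrating factor (1 + t^2)^(w/2). For functions constant along rays, a vertical line
    represents an open half meridian. *)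
Lemma meridian_value (w : R) (F : point -> R) (c s t : R) :
  smooth_off_origin F ->
  (forall p, p <> origin -> norm3 p ^ 2 * partial Az F p = - w * coord Az p * F p) ->
  c ^ 2 + s ^ 2 = 1 ->
  F (c, s, t) * Rpower (1 + t ^ 2) (w / 2) = F (c, s, 0).
Proof.
  intros HF HD Hcs.
  assert (Hoff : forall u, (c, s, u) <> origin).
  { intros u E. injection E as -> -> _. lra. }
  transitivity (F (c, s, 0) * Rpower (1 + 0 ^ 2) (w / 2)).
  - apply (zero_derivative_constant (fun u => F (c, s, u) * Rpower (1 + u ^ 2) (w / 2))).
    intro u.
    pose proof (Derive_correct _ _ (smooth_ex_partial Az F _ HF (Hoff u))) as D. simpl in D.
    pose proof (HD _ (Hoff u)) as E. rewrite <- norm3_sqr in E. simpl coord in E.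
    assert (D2 : is_derive (fun u => Rpower (1 + u ^ 2) (w / 2)) u
      (w * u / (1 + u ^ 2) * Rpower (1 + u ^ 2) (w / 2))).
    { unfold Rpower. auto_derive; [nra|]. simpl. field. nra. }
    pose proof (is_derive_mult _ _ _ _ _ D D2 Rmult_comm) as D3.
    evar_last; [exact D3|].
    assert (E' : partial Az F (c, s, u) = - w * u * F (c, s, u) / (1 + u ^ 2)).
    { apply (Rmult_eq_reg_l (1 + u ^ 2)); [|nra]. rewrite Hcs in E.
      transitivity (- w * u * F (c, s, u)); [exact E | field; nra]. }
    unfold plus, mult; simpl.
    change (Derive (fun u0 : R => F (c, s, u0)) u) with (partial Az F (c, s, u)).
    rewrite E'. simpl. field. nra.
  - replace (1 + 0 ^ 2) with 1 by ring. unfold Rpower. rewrite ln_1, Rmult_0_r, exp_0. ring.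
Qed.

(** * Highest weight functions *)

Definition equator (phi : R) : point := (cos phi, sin phi, 0).

Lemma equator_off_origin (phi : R) : equator phi <> origin.
Proof.
  intro E. injection E as Ec Es. pose proof (sin2_cos2 phi) as H.
  rewrite Ec, Es in H. unfold Rsqr in H. lra.
Qed.

Lemma is_derive_equator (F : point -> R) (phi : R) : smooth_off_origin F ->
  is_derive (fun u => F (equator u)) phi (angular Az F (equator phi)).
Proof.
  intro HF. pose proof (equator_off_origin phi) as Hoff.
  evar_last.
  - apply (chain_rule F cos sin (fun _ => 0)); [exact HF|exact Hoff| | |].
    + apply is_derive_cos.
    + apply is_derive_sin.
    + exact (is_derive_const 0 phi).
  - unfold angular, equator, zero. simpl. ring.
Qed.

Section HighestWeight.
Variables (w : R) (F1 F2 : point -> R).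
Hypothesis (S1 : smooth_off_origin F1) (S2 : smooth_off_origin F2).
Hypothesis (H1 : homogeneous F1) (H2 : homogeneous F2).
Hypothesis (HW : highest_weight w F1 F2).

(** These are the real and imaginary parts of exp(-i w phi) (F1 + i F2), constant because
    [angular Az] is the derivative along the equator. *)
Lemma highest_weight_equator (phi : R) :
  F1 (equator phi) * cos (w * phi) + F2 (equator phi) * sin (w * phi) = F1 (equator 0) /\
  F2 (equator phi) * cos (w * phi) - F1 (equator phi) * sin (w * phi) = F2 (equator 0).
Proof.
  destruct HW as (C1 & C2 & _ & _).
  assert (D1 : forall u, is_derive (fun u => F1 (equator u)) u (- w * F2 (equator u))).
  { intro u. rewrite <- C1 by apply equator_off_origin. now apply is_derive_equator. }
  assert (D2 : forall u, is_derive (fun u => F2 (equator u)) u (w * F1 (equator u))).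
  { intro u. rewrite <- C2 by apply equator_off_origin. now apply is_derive_equator. }
  assert (Dc : forall u, is_derive (fun u => cos (w * u)) u (- w * sin (w * u))).
  { intro u. auto_derive; [trivial|ring]. }
  assert (Ds : forall u, is_derive (fun u => sin (w * u)) u (w * cos (w * u))).
  { intro u. auto_derive; [trivial|ring]. }
  split.
  - rewrite (zero_derivative_constant (fun u => F1 (equator u) * cos (w * u)
      + F2 (equator u) * sin (w * u)) phi 0).
    + rewrite Rmult_0_r, cos_0, sin_0. ring.
    + intro u. evar_last.
      * apply @is_derive_plus.
        -- exact (is_derive_mult _ _ _ _ _ (D1 u) (Dc u) Rmult_comm).
        -- exact (is_derive_mult _ _ _ _ _ (D2 u) (Ds u) Rmult_comm).
      * unfold plus, mult; simpl. ring.
  - rewrite (zero_derivative_constant (fun u => F2 (equator u) * cos (w * u)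
      - F1 (equator u) * sin (w * u)) phi 0).
    + rewrite Rmult_0_r, cos_0, sin_0. ring.
    + intro u. evar_last.
      * apply @is_derive_minus.
        -- exact (is_derive_mult _ _ _ _ _ (D2 u) (Dc u) Rmult_comm).
        -- exact (is_derive_mult _ _ _ _ _ (D1 u) (Ds u) Rmult_comm).
      * unfold minus, plus, opp, mult; simpl. ring.
Qed.

Lemma angle_exists (c s : R) : c ^ 2 + s ^ 2 = 1 -> exists phi, cos phi = c /\ sin phi = s.
Proof.
  intro H. assert (Hc : -1 <= c <= 1) by nra.
  assert (Hs : sqrt (1 - Rsqr c) = Rabs s).
  { rewrite <- sqrt_Rsqr_abs. f_equal. unfold Rsqr. lra. }
  destruct (Rle_lt_dec 0 s).
  - exists (acos c). split; [now apply cos_acos|].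
    rewrite sin_acos, Hs by assumption. now apply Rabs_pos_eq.
  - exists (- acos c). rewrite cos_neg, sin_neg. split; [now apply cos_acos|].
    rewrite sin_acos, Hs, Rabs_left by assumption. ring.
Qed.

Lemma vanishes_on_axis (F : point -> R) (z : R) : smooth_off_origin F ->
  (forall u, u <> 0 -> F (u, 0, z) = 0) -> z <> 0 -> F (0, 0, z) = 0.
Proof.
  intros HF H0 Hz.
  assert (Hc : continuous (fun u => F (u, 0, z)) 0).
  { apply (continuous_comp (fun u => (u, 0, z) : point) F).
    - apply continuous_point; [apply continuous_id | apply continuous_const | apply continuous_const].
    - apply smooth_continuous; [exact HF|]. intro E. injection E as ->. now apply Hz. }
  apply NNPP. intro Hne.
  destruct (Hc (fun v => v <> 0) (open_neq 0 _ Hne)) as [eps Heps].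
  apply (Heps (eps / 2)).
  - unfold ball; simpl. unfold AbsRing_ball, abs, minus, plus, opp; simpl.
    rewrite Rabs_pos_eq; pose proof (cond_pos eps); lra.
  - apply H0. pose proof (cond_pos eps). lra.
Qed.

(** The zero spreads from (1,0,0) around the equator, then along the meridians, whose factor is
    positive, and reaches the polar axis by continuity. *)
Lemma highest_weight_zero : F1 (equator 0) = 0 -> F2 (equator 0) = 0 ->
  eq_off F1 (fun _ => 0) /\ eq_off F2 (fun _ => 0).
Proof.
  intros E1 E2.
  assert (Heq : forall phi, F1 (equator phi) = 0 /\ F2 (equator phi) = 0).
  { intro phi. destruct (highest_weight_equator phi) as [U V]. rewrite E1 in U. rewrite E2 in V.
    pose proof (sin2_cos2 (w * phi)) as T. unfold Rsqr in T.
    set (a := F1 (equator phi)) in *. set (b := F2 (equator phi)) in *.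
    set (c := cos (w * phi)) in *. set (s := sin (w * phi)) in *.
    split.
    - replace a with (a * (s * s + c * c)) by (rewrite T; ring).
      replace (a * (s * s + c * c)) with (c * (a * c + b * s) - s * (b * c - a * s)) by ring.
      rewrite U, V. ring.
    - replace b with (b * (s * s + c * c)) by (rewrite T; ring).
      replace (b * (s * s + c * c)) with (s * (a * c + b * s) + c * (b * c - a * s)) by ring.
      rewrite U, V. ring. }
  pose proof (highest_weight_partial_z w F1 F2 S1 S2 H1 H2 HW) as HD.
  assert (Gen : forall F, smooth_off_origin F -> homogeneous F ->
    (forall p, p <> origin -> norm3 p ^ 2 * partial Az F p = - w * coord Az p * F p) ->
    (forall phi, F (equator phi) = 0) -> eq_off F (fun _ => 0)).
  { intros F HF HH HDF HE.
    assert (Hcirc : forall c s t, c ^ 2 + s ^ 2 = 1 -> F (c, s, t) = 0).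
    { intros c s t Hcs. pose proof (meridian_value w F c s t HF HDF Hcs) as M.
      destruct (angle_exists c s Hcs) as (phi & <- & <-).
      fold (equator phi) in M. rewrite HE in M.
      apply Rmult_integral in M. destruct M as [M|M]; [exact M|].
      exfalso. revert M. apply Rgt_not_eq, exp_pos. }
    assert (Hgen : forall x y z, x ^ 2 + y ^ 2 <> 0 -> F (x, y, z) = 0).
    { intros x y z Hxy. set (rho := sqrt (x ^ 2 + y ^ 2)).
      assert (Hrho : 0 < rho) by (apply sqrt_lt_R0; nra).
      assert (Hsq : rho ^ 2 = x ^ 2 + y ^ 2) by (unfold rho; rewrite pow2_sqrt; nra).
      assert (Hoff : (x, y, z) <> origin).
      { intro E. injection E as -> -> _. apply Hxy. ring. }
      rewrite <- (HH (/ rho) _ (Rinv_0_lt_compat _ Hrho) Hoff).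
      apply Hcirc. simpl coord.
      replace ((/ rho * x) ^ 2 + (/ rho * y) ^ 2) with ((x ^ 2 + y ^ 2) / rho ^ 2) by (field; lra).
      rewrite Hsq. field. exact Hxy. }
    intros [[x y] z] Hp.
    destruct (Req_dec (x ^ 2 + y ^ 2) 0) as [E|E]; [|now apply Hgen].
    assert (x = 0) by nra. assert (y = 0) by nra. subst x y.
    apply vanishes_on_axis; [exact HF| |].
    - intros u Hu. apply Hgen. nra.
    - intros ->. now apply Hp. }
  split; apply Gen; trivial; try apply HD; try (intro phi; apply Heq).
Qed.

(* For negative weight the meridian formula makes the function blow up at the pole. *)
Lemma negative_weight_base (F : point -> R) :
  smooth_off_origin F -> homogeneous F -> w < 0 ->
  (forall p, p <> origin -> norm3 p ^ 2 * partial Az F p = - w * coord Az p * F p) ->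
  F (equator 0) = 0.
Proof.
  intros HF HH Hw HDF. apply NNPP. intro Hne.
  unfold equator in Hne. rewrite cos_0, sin_0 in Hne. set (K := F (1, 0, 0)) in *.
  assert (Hc : continuous (fun u => F (u, 0, 1)) 0).
  { apply (continuous_comp (fun u => (u, 0, 1) : point) F).
    - apply continuous_point; [apply continuous_id | apply continuous_const | apply continuous_const].
    - apply smooth_continuous; [exact HF|]. intro E. injection E as E. lra. }
  destruct (Hc _ (locally_ball _ (mkposreal 1 Rlt_0_1))) as [eps Heps].
  set (M := Rabs (F (0, 0, 1)) + 1).
  (* The point (1,0,t) lies on the ray through (1/t,0,1), which is within [eps] of the pole
     (0,0,1). *)
  assert (HM : forall t, / eps < t -> Rabs (F (1, 0, t)) <= M).
  { intros t Ht. pose proof (cond_pos eps) as Hpos.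
    pose proof (Rinv_0_lt_compat _ Hpos) as Hinv.
    assert (Hoff : (1, 0, t) <> origin) by (intro E; injection E as E; lra).
    assert (Ht0 : 0 < / t) by (apply Rinv_0_lt_compat; lra).
    rewrite <- (HH (/ t) _ Ht0 Hoff). unfold scale. simpl coord.
    rewrite Rmult_1_r, Rmult_0_r, Rinv_l by lra.
    assert (B : ball (F (0, 0, 1)) 1 (F (/ t, 0, 1))).
    { apply Heps. unfold ball; simpl. unfold AbsRing_ball, abs, minus, plus, opp; simpl.
      rewrite Ropp_0, Rplus_0_r, Rabs_pos_eq by lra.
      rewrite <- (Rinv_inv eps). apply Rinv_lt_contravar; [|exact Ht].
      apply Rmult_lt_0_compat; lra. }
    unfold ball in B; simpl in B. unfold AbsRing_ball, abs, minus, plus, opp in B; simpl in B.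
    unfold M. replace (F (/ t, 0, 1)) with (F (0, 0, 1) + (F (/ t, 0, 1) + - F (0, 0, 1))) by ring.
    eapply Rle_trans; [apply Rabs_triang|]. lra. }
  set (e := - w / 2). assert (He : 0 < e) by (unfold e; lra).
  assert (HK : 0 < Rabs K) by now apply Rabs_pos_lt.
  (* Both lower bounds on [L] are used with t^2 = exp L: the first gives t > 1/eps, the second |K|
     (1 + t^2)^e > |K| e L > M. *)
  set (L := 2 * / eps + M / (Rabs K * e)).
  assert (HM0 : 0 < M) by (unfold M; pose proof (Rabs_pos (F (0, 0, 1))); lra).
  pose proof (Rinv_0_lt_compat _ (cond_pos eps)) as Hinv.
  assert (HKe : 0 < Rabs K * e) by now apply Rmult_lt_0_compat.
  assert (HL : 2 * / eps < L /\ M / (Rabs K * e) < L).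
  { assert (0 < M / (Rabs K * e)) by now apply Rdiv_lt_0_compat. unfold L; lra. }
  destruct HL as [HL1 HL2].
  set (t := exp (L / 2)).
  assert (Ht : / eps < t).
  { unfold t. pose proof (exp_ineq1 (L / 2)). lra. }
  assert (Ht2 : t ^ 2 = exp L).
  { unfold t. simpl. rewrite Rmult_1_r, <- exp_plus. f_equal. field. }
  pose proof (HM t Ht) as Hb.
  pose proof (meridian_value w F 1 0 t HF HDF) as Hmer. fold K in Hmer.
  assert (Hk : F (1, 0, t) = K * Rpower (1 + t ^ 2) e).
  { rewrite <- Hmer by ring. rewrite Rmult_assoc, <- Rpower_plus.
    replace (w / 2 + e) with 0 by (unfold e; field). rewrite Rpower_O; [ring|].
    pose proof (pow2_ge_0 t). lra. }
  rewrite Hk, Rabs_mult in Hb.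
  assert (Hlow : e * L < Rpower (1 + t ^ 2) e).
  { unfold Rpower. rewrite Ht2.
    assert (L < ln (1 + exp L)).
    { rewrite <- (ln_exp L) at 1. apply ln_increasing; [apply exp_pos|]. lra. }
    assert (e * L < e * ln (1 + exp L)) by (apply Rmult_lt_compat_l; assumption).
    assert (0 < e * L) by (apply Rmult_lt_0_compat; lra).
    pose proof (exp_ineq1 (e * ln (1 + exp L))). lra. }
  rewrite (Rabs_pos_eq (Rpower _ _)) in Hb by (left; apply exp_pos).
  assert (M < Rabs K * Rpower (1 + t ^ 2) e).
  { replace M with (Rabs K * (e * (M / (Rabs K * e)))) by (field; split; lra).
    apply Rmult_lt_compat_l; [exact HK|].
    apply Rlt_trans with (e * L); [|exact Hlow].
    now apply Rmult_lt_compat_l. }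
  lra.
Qed.

Lemma negative_weight : w < 0 -> eq_off F1 (fun _ => 0) /\ eq_off F2 (fun _ => 0).
Proof.
  intro Hw. pose proof (highest_weight_partial_z w F1 F2 S1 S2 H1 H2 HW) as HD.
  apply highest_weight_zero; apply negative_weight_base; trivial;
    intros p Hp; now apply HD.
Qed.

(* Going once around the equator multiplies a function of weight [w] by exp(2 i pi w). *)
Lemma weight_integer : ~ (eq_off F1 (fun _ => 0) /\ eq_off F2 (fun _ => 0)) ->
  exists k : Z, w = IZR k.
Proof.
  intro Hne.
  assert (Hbase : F1 (equator 0) <> 0 \/ F2 (equator 0) <> 0).
  { apply NNPP. intro H. apply Hne, highest_weight_zero; apply NNPP; tauto. }
  destruct (highest_weight_equator (2 * PI)) as [U V].
  assert (E0 : equator (2 * PI) = equator 0).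
  { unfold equator. now rewrite cos_2PI, sin_2PI, cos_0, sin_0. }
  rewrite E0 in U, V. set (a := F1 (equator 0)) in *. set (b := F2 (equator 0)) in *.
  set (c := cos (w * (2 * PI))) in *. set (s := sin (w * (2 * PI))) in *.
  assert (Hc : c = 1).
  { assert (E : (a * a + b * b) * (c - 1) = a * (a * c + b * s - a) + b * (b * c - a * s - b)) by ring.
    rewrite U, V in E.
    replace (a * (a - a) + b * (b - b)) with 0 in E by ring.
    apply Rmult_integral in E. destruct E as [E|E]; [exfalso|lra].
    assert (a = 0) by nra. assert (b = 0) by nra. tauto. }
  assert (Hs : sin (w * PI) = 0).
  { unfold c in Hc. replace (w * (2 * PI)) with (2 * (w * PI)) in Hc by ring.
    rewrite cos_2a_sin in Hc. nra. }
  apply sin_eq_0_0 in Hs. destruct Hs as [k Hk]. exists k.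
  apply (Rmult_eq_reg_r PI); [exact Hk | apply PI_neq0].
Qed.
End HighestWeight.

(** * Sectoral harmonics *)

Fixpoint sectoral (k : nat) : (point -> R) * (point -> R) :=
  match k with
  | O => ((fun _ => 1), (fun _ => 0))
  | S k => let (F, G) := sectoral k in
    ((fun p => (coord Ax p * rinv p) * F p - (coord Ay p * rinv p) * G p),
     (fun p => (coord Ax p * rinv p) * G p + (coord Ay p * rinv p) * F p))
  end.

Lemma angular_coord (i k : axis) (p : point) : angular i (coord k) p =
  match i, k with
  | Ax, Ay => - coord Az p | Ax, Az => coord Ay p
  | Ay, Az => - coord Ax p | Ay, Ax => coord Az p
  | Az, Ax => - coord Ay p | Az, Ay => coord Ax p
  | _, _ => 0
  end.
Proof. destruct i, k; unfold angular; rewrite !partial_coord; unfold delta; ring. Qed.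

Lemma angular_rinv (i : axis) (p : point) : p <> origin -> angular i rinv p = 0.
Proof.
  intro Hp.
  assert (D : forall k, partial k rinv p = - coord k p * rinv p * rinv p * rinv p).
  { intro k. apply is_derive_unique. now apply is_derive_rinv. }
  destruct i; unfold angular; rewrite !D; ring.
Qed.

Lemma homogeneous_coord_rinv (k : axis) : homogeneous (fun p => coord k p * rinv p).
Proof.
  intros l p Hl Hp. unfold rinv. rewrite norm3_scale, coord_scale by assumption.
  field. split; [apply Rgt_not_eq; now apply norm3_pos | lra].
Qed.

(** Rotations are derivations that kill 1/r, and (x + iy)/r is itself a highest weight function of
    weight 1; weights add under multiplication. The value at (1,0,0) records that the function is
    nonzero. *)
Lemma sectoral_spec (k : nat) : let (F, G) := sectoral k in
  smooth_off_origin F /\ smooth_off_origin G /\ homogeneous F /\ homogeneous G /\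
  highest_weight (INR k) F G /\ F (1, 0, 0) = 1 /\ G (1, 0, 0) = 0.
Proof.
  induction k as [|k IH].
  - simpl. split; [apply smooth_const|]. split; [apply smooth_const|].
    split; [easy|]. split; [easy|]. split; [|easy].
    assert (Z : forall i c p, angular i (fun _ => c) p = 0).
    { intros i c p. assert (D : forall j, partial j (fun _ => c) p = 0) by (intro; exact (Derive_const c _)).
      destruct i; unfold angular; rewrite !D; ring. }
    repeat split; intros p _; rewrite !Z; ring.
  - simpl sectoral. destruct (sectoral k) as [F G].
    destruct IH as (SF & SG & HF & HG & (C1 & C2 & B1 & B2) & F0 & G0).
    set (u := fun p => coord Ax p * rinv p). set (v := fun p => coord Ay p * rinv p).
    assert (Su : smooth_off_origin u)
      by (apply smooth_mult; [apply smooth_coord | apply smooth_rinv]).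
    assert (Sv : smooth_off_origin v)
      by (apply smooth_mult; [apply smooth_coord | apply smooth_rinv]).
    assert (Hu : homogeneous u) by apply homogeneous_coord_rinv.
    assert (Hv : homogeneous v) by apply homogeneous_coord_rinv.
    split; [apply smooth_minus; now apply smooth_mult|].
    split; [apply smooth_plus; now apply smooth_mult|].
    split; [intros l p Hl Hp; fold u v; cbv beta|].
    { change (u (scale l p) * F (scale l p) - v (scale l p) * G (scale l p) = u p * F p - v p * G p).
      now rewrite Hu, Hv, HF, HG by assumption. }
    split.
    { intros l p Hl Hp.
      change (u (scale l p) * G (scale l p) + v (scale l p) * F (scale l p) = u p * G p + v p * F p).
      now rewrite Hu, Hv, HF, HG by assumption. }
    assert (Rk : forall i c p, p <> origin ->
      angular i (fun q => coord c q * rinv q) p = angular i (coord c) p * rinv p).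
    { intros i c p Hp. rewrite angular_mult, angular_rinv by auto using smooth_coord, smooth_rinv. ring. }
    assert (RM : forall i p, p <> origin ->
      angular i (fun q => u q * F q - v q * G q) p =
        angular i u p * F p + u p * angular i F p - (angular i v p * G p + v p * angular i G p)).
    { intros i p Hp. now rewrite angular_minus, !angular_mult by auto using smooth_mult. }
    assert (RP : forall i p, p <> origin ->
      angular i (fun q => u q * G q + v q * F q) p =
        angular i u p * G p + u p * angular i G p + (angular i v p * F p + v p * angular i F p)).
    { intros i p Hp. now rewrite angular_plus, !angular_mult by auto using smooth_mult. }
    split.
    + change (highest_weight (INR (S k))
        (fun q => u q * F q - v q * G q) (fun q => u q * G q + v q * F q)).
      rewrite S_INR.
      repeat split; intros p Hp; rewrite ?RM, ?RP by assumption; unfold u, v;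
        rewrite !Rk by assumption; rewrite !angular_coord;
        rewrite ?C1, ?C2, ?B1, ?B2 by assumption; ring.
    + simpl. rewrite F0, G0. unfold rinv, norm3.
      replace (1 ^ 2 + 0 ^ 2 + 0 ^ 2) with 1 by ring. rewrite sqrt_1. lra.
Qed.

Lemma harmonic_nontrivial (k : nat) :
  exists F, harmonic (INR k * (INR k + 1)) F /\ F (1, 0, 0) <> 0.
Proof.
  pose proof (sectoral_spec k) as H. destruct (sectoral k) as [F G].
  destruct H as (SF & SG & HF & HG & HW & F0 & _).
  exists F. split; [|lra]. split; [exact SF|]. split; [exact HF|].
  now apply (highest_weight_casimir (INR k) F G).
Qed.

(** * Dimension of the eigenspaces *)

Module Spectrum.
Import all_boot all_order all_algebra Rstruct.
Set Implicit Arguments. Unset Strict Implicit. Unset Printing Implicit Defensive.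
Import Order.TTheory GRing.Theory Num.Theory.
Local Open Scope ring_scope.

Lemma sum_n_m_big (f : nat -> R) (n : nat) : sum_n_m f 1 n = \sum_(i < n) f i.+1.
Proof.
elim: n => [|n IH]; first by rewrite big_ord0 sum_n_m_zero //; lia.
by rewrite big_ord_recr -IH sum_n_Sm //; lia.
Qed.

Section LinearCombinations.
Variables (I : Type) (E : I -> point -> R).
Hypothesis (Es : forall i, smooth_off_origin (E i)).

Lemma smooth_lincomb (s : seq I) (c : I -> R) :
  smooth_off_origin (fun p => \sum_(i <- s) c i * E i p).
Proof.
elim: s => [|i s IH].
  by apply: smooth_eq_off (smooth_const 0) => p _; rewrite big_nil.
apply: (@smooth_eq_off (fun p => c i * E i p + \sum_(i <- s) c i * E i p)).
  by move=> p _; rewrite big_cons.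
by apply: smooth_plus IH; apply: smooth_mult (Es i); apply: smooth_const.
Qed.

Lemma angular_lincomb (a : axis) (s : seq I) (c : I -> R) p : p <> origin ->
  angular a (fun p => \sum_(i <- s) c i * E i p) p = \sum_(i <- s) c i * angular a (E i) p.
Proof.
move=> hp; elim: s => [|i s IH].
  rewrite big_nil (@angular_ext a _ (fun p => 0%R * 0%R) _ p) //; last first.
    by move=> q _; rewrite big_nil mul0r.
  by rewrite (angular_scal a 0%R (fun _ => 0)) Rmult_0_l.
transitivity (angular a (fun q => Rplus (Rmult (c i) (E i q)) (\sum_(i <- s) c i * E i q)) p).
  by apply: angular_ext hp => q _; rewrite big_cons.
rewrite angular_plus //; first by rewrite angular_scal IH big_cons.
- by apply: smooth_mult (Es i); apply: smooth_const.
- exact: smooth_lincomb.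
Qed.
End LinearCombinations.

Section Dimension.
Variables (mu : R) (m : nat) (E : 'I_m.+1 -> point -> R).
Hypothesis (mu_ge0 : Rle 0 mu).
Hypothesis Eharm : forall i, harmonic mu (E i).
Hypothesis Efree : forall v : 'rV[R]_m.+1,
  eq_off (fun p => \sum_i v 0 i * E i p) (fun=> 0) -> v = 0.
Hypothesis Espan : forall F, harmonic mu F ->
  exists v : 'rV[R]_m.+1, eq_off F (fun p => \sum_i v 0 i * E i p).

Let T (v : 'rV[R]_m.+1) p := \sum_i v 0 i * E i p.

Let Es i : smooth_off_origin (E i). Proof. by have [] := Eharm i. Qed.

Let T_smooth v : smooth_off_origin (T v). Proof. exact: smooth_lincomb. Qed.

Let T_homogeneous v : homogeneous (T v).
Proof.
move=> l p hl hp; apply: eq_bigr => i _; congr (_ * _).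
by have [_ [h _]] := Eharm i; apply: h.
Qed.

Let T_inj u v : eq_off (T u) (T v) -> u = v.
Proof.
move=> e; apply/eqP; rewrite -subr_eq0; apply/eqP/Efree => p hp.
have := e p hp; rewrite /T => e'; under eq_bigr do rewrite !mxE mulrBl.
by rewrite sumrB e' subrr.
Qed.

Let T_scale c v p : T (c *: v) p = c * T v p.
Proof. by rewrite /T big_distrr /=; apply: eq_bigr => i _; rewrite mxE mulrA. Qed.

Let T_add u v p : T (u + v) p = T u p + T v p.
Proof. by rewrite /T -big_split /=; apply: eq_bigr => i _; rewrite mxE mulrDl. Qed.

Let T_opp v p : T (- v) p = - T v p.
Proof. by rewrite -scaleN1r T_scale mulN1r. Qed.

Let T_harmonic v : harmonic mu (T v).
Proof.
split; [exact: T_smooth | split; [exact: T_homogeneous|]] => p hp.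
rewrite /casimir.
have two a : angular a (angular a (T v)) p = \sum_i v 0 i * angular a (angular a (E i)) p.
  transitivity (angular a (fun q => \sum_i v 0 i * angular a (E i) q) p).
    by apply: angular_ext hp => q hq; rewrite angular_lincomb.
  by rewrite angular_lincomb // => i; apply: smooth_angular.
rewrite !two !RplusE.
transitivity (\sum_i v 0 i * (- mu * E i p)).
  rewrite -!big_split /=; apply: eq_bigr => i _; rewrite -!mulrDr; congr (_ * _).
  have [_ [_ h]] := Eharm i; by have := h p hp; rewrite /casimir !RplusE => ->.
by rewrite [RHS]big_distrr /=; apply: eq_bigr => i _; rewrite mulrCA.
Qed.

Lemma angular_matrix a : exists M : 'M[R]_m.+1,
  forall v, eq_off (angular a (T v)) (T (v *m M)).
Proof.
have h i : {v : 'rV[R]_m.+1 | eq_off (angular a (E i)) (fun p => \sum_i v 0 i * E i p)}.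
  by apply: boolp.cid; apply: Espan; apply: harmonic_angular.
exists (\matrix_i (sval (h i))) => v p hp.
rewrite angular_lincomb //.
under eq_bigr => i _ do rewrite (svalP (h i) p hp) big_distrr /=.
rewrite exchange_big /=; apply: eq_bigr => j _.
by rewrite mxE big_distrl /=; apply: eq_bigr => i _; rewrite !mxE mulrA.
Qed.

Lemma matrix_ext (M N : 'M[R]_m.+1) :
  (forall v, eq_off (T (v *m M)) (T (v *m N))) -> M = N.
Proof. by move=> e; apply/row_matrixP => i; rewrite !rowE; exact: T_inj. Qed.

Lemma harmonic_dimension :
  exists k : nat, mu = Rmult (INR k) (Rplus (INR k) 1) /\ m.+1 = (2 * k + 1)%N.
Proof.
have [A hA] := angular_matrix Ax; have [B hB] := angular_matrix Ay.
have [C hC] := angular_matrix Az.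
(* Coordinates are row vectors, so [M *m N] applies the rotation of [M] first. This reversal turns
   the minus signs of [angular_comm] into the plus signs of the algebraic relations. *)
have comp a b (M N : 'M[R]_m.+1) v : (forall v, eq_off (angular a (T v)) (T (v *m M))) ->
    (forall v, eq_off (angular b (T v)) (T (v *m N))) ->
    eq_off (T (v *m (M *m N))) (angular b (angular a (T v))).
  move=> hM hN p hp; rewrite mulmxA -hN //; apply: angular_ext hp => q hq.
  by rewrite hM.
have sub_swap (x y z : R) : Rminus x y = Ropp z -> y - x = z.
  by move=> h; change (Rminus y x = z); lra.
have commutator a b (L M N : 'M[R]_m.+1) :
    (forall v, eq_off (angular a (T v)) (T (v *m L))) ->
    (forall v, eq_off (angular b (T v)) (T (v *m M))) ->
    (forall v p, p <> origin -> T (v *m N) p =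
       angular b (angular a (T v)) p - angular a (angular b (T v)) p) ->
    L *m M - M *m L = N.
  move=> hL hM hN; apply: matrix_ext => v p hp.
  by rewrite mulmxBr T_add T_opp (comp _ _ _ _ v hL hM) // (comp _ _ _ _ v hM hL) // hN.
have AB : A *m B - B *m A = C.
  apply: (commutator Ax Ay) => // v p hp; rewrite -hC //; apply/esym/sub_swap.
  by have [] := angular_comm _ _ (T_smooth v) hp.
have BC : B *m C - C *m B = A.
  apply: (commutator Ay Az) => // v p hp; rewrite -hA //; apply/esym/sub_swap.
  by have [_ []] := angular_comm _ _ (T_smooth v) hp.
have CA : C *m A - A *m C = B.
  apply: (commutator Az Ax) => // v p hp; rewrite -hB //; apply/esym/sub_swap.
  by have [_ []] := angular_comm _ _ (T_smooth v) hp.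
have [j [j_ge0 Dmu]] : exists j : R, Rle 0 j /\ mu = Rmult j (Rplus j 1).
  (* The larger root of j^2 + j = mu, nonnegative because mu is. *)
  exists (Rdiv (Rminus (sqrt (Rplus 1 (Rmult 4 mu))) 1) 2).
  have h : Rle 1 (sqrt (Rplus 1 (Rmult 4 mu))) by rewrite -[X in Rle X _]sqrt_1; apply: sqrt_le_1; lra.
  by split; [lra|]; have := sqrt_sqrt (Rplus 1 (Rmult 4 mu)); lra.
have cas : A *m A + B *m B + C *m C = (- (j * (j + 1)))%:M.
  apply: matrix_ext => v p hp.
  rewrite !mulmxDr !T_add (comp _ _ _ _ v hA hA) // (comp _ _ _ _ v hB hB) //.
  rewrite (comp _ _ _ _ v hC hC) // mul_mx_scalar T_scale.
  have : casimir (T v) p = Rmult (Ropp mu) (T v p).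
    have Tharm := T_harmonic v.
    by have [_ [_ ->]] := Tharm.
  by rewrite Dmu.
(* Evaluation at (1,0,0), the functional that determines a highest weight function. *)
pose ev : 'cV[R]_m.+1 := \col_i E i (equator 0).
have evT v : v *m ev = 0 -> T v (equator 0) = 0.
  move=> e; have := congr1 (fun M : 'M[R]_1 => M 0 0) e; rewrite !mxE => <-.
  by apply: eq_bigr => i _; rewrite mxE.
have hw w a b : RotationAlgebra.hw_pair A B C w a b -> highest_weight w (T a) (T b).
  case=> aC bC aB bB; split; [|split; [|split]] => p hp.
  - by rewrite hC // aC T_scale.
  - by rewrite hC // bC T_scale.
  - by rewrite hB // hA // aB T_opp.
  - by rewrite hB // hA // bB.
have T0 v : eq_off (T v) (fun=> 0) -> v = 0 by move=> e; apply: Efree.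
have neg w a b : w < 0 -> RotationAlgebra.hw_pair A B C w a b -> a = 0 /\ b = 0.
  move=> /RltP w0 /hw h.
  have [h1 h2] := negative_weight _ _ _ (T_smooth _) (T_smooth _)
    (@T_homogeneous _) (@T_homogeneous _) h w0.
  by split; apply: T0.
have inj w a b : RotationAlgebra.hw_pair A B C w a b -> a *m ev = 0 -> b *m ev = 0 -> a = 0 /\ b = 0.
  move=> /hw h /evT a0 /evT b0.
  have [h1 h2] := highest_weight_zero _ _ _ (T_smooth _) (T_smooth _)
    (@T_homogeneous _) (@T_homogeneous _) h a0 b0.
  by split; apply: T0.
have j0 : 0 <= j by apply/RleP.
have [dim [a [b [/hw h ab0]]]] := RotationAlgebra.so3_dimension j0 AB BC CA cas neg inj.
(* Here the real root [j] becomes an integer: it is the weight of the nonzero pair just obtained. *)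
have [|z jz] := weight_integer _ _ _ (T_smooth _) (T_smooth _)
    (@T_homogeneous _) (@T_homogeneous _) h.
  case=> /T0 a0 /T0 b0; case: ab0; rewrite ?a0 ?b0 eqxx //.
have z_ge0 : Z.le 0 z by apply: le_IZR; rewrite -jz.
have jk : j = INR (Z.to_nat z) by rewrite INR_IZR_INZ Z2Nat.id.
exists (Z.to_nat z); rewrite -jk; split=> //.
apply/eqP; rewrite -(eqr_nat R) dim natrD natrM -[(Z.to_nat z)%:R]INRE -jk; apply/eqP.
by [].
Qed.
End Dimension.

Lemma eigenspace_dimension (mu : R) (n : nat) :
  Rle 0 mu -> has_dim_S2 (Defs.eigenspace mu) n -> n <> 0%N ->
  exists k : nat, mu = Rmult (INR k) (Rplus (INR k) 1) /\ n = Nat.add (Nat.mul 2 k) 1.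
Proof.
move=> mu0 [e [eE [efree espan]]]; case: n eE efree espan => // m eE efree espan _.
(* Bases are indexed from 1 in [has_dim_S2] and from 0 by ordinals, hence the shift, undone below by
   [inord l.-1]. *)
pose E (i : 'I_m.+1) := extend0 (e i.+1).
have sumE (c : nat -> R) p : S2 p ->
    sum_n_m (fun i => Rmult (c i) (e i p)) 1 m.+1 = \sum_(i < m.+1) c i.+1 * E i p.
  by move=> hp; rewrite sum_n_m_big; apply: eq_bigr => i _; rewrite /E extend0_S2.
apply: (@harmonic_dimension mu m E) => //.
- move=> i; apply: eigenspace_harmonic; apply: eE; split; first lia.
  by apply/ssrnat.leP; apply: ltn_ord.
- move=> v v0; apply/rowP => i; rewrite mxE.
  have := efree (fun l => v 0 (inord l.-1)) _ i.+1; rewrite /= inord_val; apply.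
    move=> p hp; rewrite sumE // -[RHS](v0 p (S2_off_origin p hp)).
    by apply: eq_bigr => l _; rewrite /= inord_val.
  by split; [lia | apply/ssrnat.leP; apply: ltn_ord].
- move=> F hF; have [c hc] := espan F (harmonic_eigenspace _ _ hF).
  exists (\row_i c (nat_of_ord i).+1); apply: homogeneous_eq_off.
  + by have [_ []] := hF.
  + move=> l p hl hp; apply: eq_bigr => i _; congr (_ * _).
    exact: homogeneous_extend0.
  + by move=> p hp; rewrite hc // sumE //; apply: eq_bigr => i _; rewrite mxE.
Qed.

Lemma eigenspace_nontrivial (k n : nat) :
  has_dim_S2 (Defs.eigenspace (Rmult (INR k) (Rplus (INR k) 1))) n -> n <> 0%N.
Proof.
move=> [e [_ [_ espan]]] n0; have [F [hF F0]] := harmonic_nontrivial k.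
have [c hc] := espan F (harmonic_eigenspace _ _ hF).
apply: F0; rewrite hc; last first.
  by rewrite /S2 /norm3 -[RHS]sqrt_1; congr sqrt; rewrite /=; lra.
by rewrite n0 sum_n_m_zero //; lia.
Qed.

End Spectrum.

(** * The counting function and its average *)

Lemma has_card_unique (S : nat -> Prop) (n m : nat) : has_card S n -> has_card S m -> n = m.
Proof.
  intros (l & Hl & <- & El) (l' & Hl' & <- & El').
  apply Nat.le_antisymm; apply NoDup_incl_length; try assumption;
    intros j Hj; [apply El', El | apply El, El']; exact Hj.
Qed.

Lemma has_card_ext (S S' : nat -> Prop) (n : nat) :
  (forall j, S j <-> S' j) -> has_card S n -> has_card S' n.
Proof.
  intros E (l & Hl & Hn & El). exists l. repeat split; trivial; intro Hj.
  - now apply E, El.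
  - now apply El, E.
Qed.

Lemma has_card_union (S S' : nat -> Prop) (n m : nat) :
  (forall j, S j -> ~ S' j) -> has_card S n -> has_card S' m ->
  has_card (fun j => S j \/ S' j) (n + m).
Proof.
  intros D (l & Hl & <- & El) (l' & Hl' & <- & El'). exists (l ++ l'). split; [|split].
  - apply NoDup_app; trivial. intros j Hj Hj'. apply (D j); [now apply El | now apply El'].
  - apply length_app.
  - intro j. rewrite in_app_iff, El, El'. tauto.
Qed.

Lemma has_card_empty (S : nat -> Prop) : (forall j, ~ S j) -> has_card S 0.
Proof.
  intro H. exists nil. split; [constructor|]. split; [reflexivity|].
  intro j. split; [easy | intro Hj; exact (H j Hj)].
Qed.

Lemma has_card_inhabited (S : nat -> Prop) (n j : nat) : has_card S n -> S j -> n <> 0%nat.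
Proof.
  intros (l & _ & <- & El) Hj. apply El in Hj. destruct l; [easy|discriminate].
Qed.

Section Counting.
Variables (lam : nat -> R) (N : R -> nat).
Hypothesis (Hlam : eigenvalue_sequence_S2 lam) (HN : counting_function lam N).

Lemma lam_nonneg (j : nat) : 0 <= lam j.
Proof.
  destruct Hlam as (H0 & Hinc & _). induction j as [|j IH]; [exact H0|].
  eapply Rle_trans; [exact IH | apply Hinc].
Qed.

Lemma lam_form (j : nat) : exists k : nat, lam j = INR k * (INR k + 1).
Proof.
  destruct Hlam as (_ & _ & _ & H). destruct (H (lam j)) as (n & Hdim & Hcard).
  destruct (Spectrum.eigenspace_dimension (lam_nonneg j) Hdim) as (k & Hk & _).
  - now apply (has_card_inhabited _ n j Hcard).
  - now exists k.
Qed.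

Lemma quadratic_lt (a b : nat) : INR a * (INR a + 1) < INR b * (INR b + 1) <-> (a < b)%nat.
Proof.
  pose proof (pos_INR a). pose proof (pos_INR b). split; intro H1.
  - apply INR_lt. nra.
  - apply lt_INR in H1. nra.
Qed.

(** The same n counts the dimension and the occurrences. It is nonzero by the sectoral functions,
    hence equal to 2k' + 1 with k'(k'+1) = k(k+1), and strict monotonicity gives k' = k. *)
Lemma lam_multiplicity (k : nat) :
  has_card (fun j => lam j = INR k * (INR k + 1)) (2 * k + 1).
Proof.
  destruct Hlam as (_ & _ & _ & H).
  destruct (H (INR k * (INR k + 1))) as (n & Hdim & Hcard).
  pose proof (Spectrum.eigenspace_nontrivial Hdim) as Hn.
  assert (Hmu : 0 <= INR k * (INR k + 1)) by (pose proof (pos_INR k); nra).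
  destruct (Spectrum.eigenspace_dimension Hmu Hdim Hn) as (k' & Hk & E).
  assert (k' = k).
  { pose proof (quadratic_lt k k'). pose proof (quadratic_lt k' k).
    destruct (Nat.lt_trichotomy k k') as [L|[L|L]]; [|lia|]; [apply H0 in L|apply H1 in L]; lra. }
  subst k'. now rewrite <- E.
Qed.

(** The values below m(m+1) are those with k < m, and 1 + 3 + ... + (2m - 1) = m^2. The strict
    inequality lets the induction start from the empty set. *)
Lemma card_lam_lt (m : nat) : has_card (fun j => lam j < INR m * (INR m + 1)) (m * m).
Proof.
  induction m as [|m IH].
  - apply has_card_empty. intro j. simpl. pose proof (lam_nonneg j). lra.
  - replace (S m * S m)%nat with (m * m + (2 * m + 1))%nat by lia.
    apply has_card_ext with (fun j => lam j < INR m * (INR m + 1) \/ lam j = INR m * (INR m + 1)).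
    + intro j. destruct (lam_form j) as [k ->]. rewrite !quadratic_lt.
      split.
      * intros [L|L]; [lia|]. apply (quadratic_lt k (S m)). rewrite L.
        apply quadratic_lt. lia.
      * intro L. destruct (Nat.eq_dec k m) as [->|]; [now right | left; lia].
    + apply has_card_union; [intros j; lra | exact IH | apply lam_multiplicity].
Qed.

(** The eigenvalue (m-1)m is already counted at the left end of the interval, and the next one is
    m(m+1). *)
Lemma counting_value (m : nat) (t : R) :
  INR m * (INR m - 1) <= t < INR m * (INR m + 1) -> N t = (m * m)%nat.
Proof.
  intros Ht. apply (has_card_unique (fun j => lam j <= t)); [apply HN|].
  apply has_card_ext with (2 := card_lam_lt m). intro j. split; intro L; [|lra].
  destruct (lam_form j) as [k Hk]. rewrite Hk in *. apply quadratic_lt in L.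
  apply le_INR in L. rewrite S_INR in L. pose proof (pos_INR k). nra.
Qed.

(** The right end may be included although the counting function jumps there, since the integrands
    are compared on the open interval only. *)
Lemma RInt_counting_piece (m : nat) (t : R) :
  INR m * (INR m - 1) <= t <= INR m * (INR m + 1) ->
  is_RInt (fun s => INR (N s)) (INR m * (INR m - 1)) t (INR m ^ 2 * (t - INR m * (INR m - 1))).
Proof.
  intro Ht. apply is_RInt_ext with (fun _ => INR m ^ 2).
  - rewrite Rmin_left, Rmax_right by lra. intros s Hs.
    change (INR m ^ 2 = INR (N s)). rewrite (counting_value m s), mult_INR by lra. ring.
  - rewrite (Rmult_comm (INR m ^ 2)). exact (is_RInt_const _ _ (INR m ^ 2)).
Qed.

(** The plateau of height k^2 has length 2k, so this is twice a sum of cubes. *)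
Lemma RInt_counting (m : nat) :
  is_RInt (fun s => INR (N s)) 0 (INR (S m) * (INR (S m) - 1))
    (INR (S m) ^ 2 * (INR (S m) - 1) ^ 2 / 2).
Proof.
  induction m as [|m IH].
  - simpl. replace (1 * (1 - 1)) with 0 by ring.
    evar_last; [apply @is_RInt_point|]. unfold zero; simpl. lra.
  - rewrite S_INR at 1 2 3 4. set (x := INR (S m)) in *.
    assert (0 <= x) by apply pos_INR.
    pose proof (RInt_counting_piece (S m) (x * (x + 1))) as P. fold x in P.
    replace ((x + 1) * (x + 1 - 1)) with (x * (x + 1)) by ring.
    evar_last.
    + apply @is_RInt_Chasles with (x * (x - 1)); [exact IH | apply P; nra].
    + unfold plus; simpl. field.
Qed.

Lemma average_error_value (m : nat) (t : R) : (1 <= m)%nat -> 0 < t ->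
  INR m * (INR m - 1) <= t < INR m * (INR m + 1) ->
  average_error N t = (- (t - INR m ^ 2) ^ 2 / 2 + INR m ^ 2 / 2 - t / 3) / t.
Proof.
  intros Hm Ht0 Ht. destruct m as [|m]; [lia|].
  pose proof (RInt_counting_piece (S m) t) as P. pose proof (RInt_counting m) as Q.
  set (x := INR (S m)) in *.
  assert (I1 : is_RInt (fun s => INR (N s)) 0 t
    (x ^ 2 * (x - 1) ^ 2 / 2 + x ^ 2 * (t - x * (x - 1)))).
  { apply @is_RInt_Chasles with (x * (x - 1)); [exact Q | apply P; lra]. }
  assert (I2 : is_RInt Ntilde 0 t (t ^ 2 / 2 + t / 3)).
  { evar_last.
    - apply (is_RInt_derive (fun s => s ^ 2 / 2 + s / 3)).
      + intros s _. unfold Ntilde. auto_derive; [trivial|]. field.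
      + intros s _. apply (continuous_plus (fun s => s) (fun _ => 1 / 3));
          [apply continuous_id | apply continuous_const].
    - unfold minus, plus, opp; simpl. field. }
  pose proof (is_RInt_minus _ _ _ _ _ _ I1 I2) as I3.
  unfold average_error.
  replace (RInt _ 0 t) with (x ^ 2 * (x - 1) ^ 2 / 2 + x ^ 2 * (t - x * (x - 1)) - (t ^ 2 / 2 + t / 3)).
  - field. lra.
  - symmetry. apply is_RInt_unique. exact I3.
Qed.
End Counting.

(** * The periodic function [g] *)

Lemma Int_part_bounds (x : R) : IZR (Int_part x) <= x < IZR (Int_part x) + 1.
Proof. destruct (base_Int_part x). lra. Qed.

Lemma nearest_integer (x : R) : - (1 / 2) <= x - IZR (Int_part (x + 1 / 2)) < 1 / 2.
Proof. pose proof (Int_part_bounds (x + 1 / 2)). lra. Qed.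

Lemma g_near (x : R) (n : Z) : - (1 / 2) <= x - IZR n < 1 / 2 ->
  g x = 1 / 6 - 2 * (x - IZR n) ^ 2.
Proof.
  intro H. unfold g. now rewrite <- (Int_part_spec (x + 1 / 2) n) by lra.
Qed.

(** [g] is the upper envelope of these parabolas, because [x + 1/2] is an integer nearest to x. *)
Lemma g_max (x : R) (n : Z) : 1 / 6 - 2 * (x - IZR n) ^ 2 <= g x.
Proof.
  pose proof (nearest_integer x) as H. unfold g. set (k := Int_part _) in *.
  destruct (Z.lt_trichotomy n k) as [L|[->|L]]; [|lra|].
  - assert (L' : (n + 1 <= k)%Z) by lia. apply IZR_le in L'. rewrite plus_IZR in L'. nra.
  - assert (L' : (k + 1 <= n)%Z) by lia. apply IZR_le in L'. rewrite plus_IZR in L'. nra.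
Qed.

(** Bounding [g x] from below by the parabola that is active at [y] avoids any case distinction at
    the jumps of [Int_part]. *)
Lemma g_variation (x y : R) : g y - g x <= 2 * Rabs (x - y) + 2 * Rabs (x - y) ^ 2.
Proof.
  pose proof (g_max x (Int_part (y + 1 / 2))) as H. pose proof (nearest_integer y) as Hy.
  rewrite pow2_abs. unfold g at 1. set (n := Int_part _) in *.
  assert (- (2 * (y - IZR n) * (x - y)) <= 2 * (1 / 2) * Rabs (x - y)
    /\ 2 * (y - IZR n) * (x - y) <= 2 * (1 / 2) * Rabs (x - y)).
  { unfold Rabs. destruct (Rcase_abs (x - y)); split; nra. }
  nra.
Qed.

Lemma g_continuous (x : R) : continuous g x.
Proof.
  apply continuity_pt_filterlim. intros eps Heps.
  (* For |x - y| at most 1 the variation is at most 4 |x - y|, hence less than [eps]. *)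
  exists (Rmin 1 (eps / 5)). split.
  - apply Rmin_pos; lra.
  - intros y [_ Hy]. simpl in *. unfold R_dist in *.
    pose proof (Rmin_l 1 (eps / 5)). pose proof (Rmin_r 1 (eps / 5)).
    pose proof (g_variation x y) as V1. pose proof (g_variation y x) as V2.
    rewrite (Rabs_minus_sym x y) in V1. pose proof (Rabs_pos (y - x)).
    assert (Rabs (y - x) ^ 2 <= Rabs (y - x)) by nra.
    apply Rle_lt_trans with (4 * Rabs (y - x)); [|lra]. apply Rabs_le. lra.
Qed.

Lemma g_periodic (x : R) : g (x + 1) = g x.
Proof.
  pose proof (nearest_integer x) as H.
  rewrite (g_near (x + 1) (Int_part (x + 1 / 2) + 1)) by (rewrite plus_IZR; lra).
  rewrite plus_IZR. unfold g. ring.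
Qed.

Lemma RInt_g_half (a b : R) (n : Z) : a <= b -> - (1 / 2) <= a - IZR n -> b - IZR n <= 1 / 2 ->
  is_RInt g a b ((b - a) / 6 - 2 / 3 * ((b - IZR n) ^ 3 - (a - IZR n) ^ 3)).
Proof.
  intros Hab Ha Hb. apply is_RInt_ext with (fun x => 1 / 6 - 2 * (x - IZR n) ^ 2).
  - rewrite Rmin_left, Rmax_right by lra. intros x Hx. symmetry. apply g_near. lra.
  - evar_last.
    + apply (is_RInt_derive (fun x => x / 6 - 2 / 3 * (x - IZR n) ^ 3)).
      * intros x _. auto_derive; [trivial|]. field.
      * intros x _. apply (ex_derive_continuous (fun x => 1 / 6 - 2 * (x - IZR n) ^ 2)).
        auto_derive. trivial.
    + unfold minus, plus, opp; simpl. field.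
Qed.

Lemma g_mean_value : mean_value g 1 = 0.
Proof.
  unfold mean_value. rewrite (is_RInt_unique g 0 1 0); [ring|].
  evar_last.
  (* At 1/2 the nearest integer changes from 0 to 1. *)
  - apply @is_RInt_Chasles with (1 / 2).
    + apply (RInt_g_half 0 (1 / 2) 0); lra.
    + apply (RInt_g_half (1 / 2) 1 1); lra.
  - unfold plus; simpl. field.
Qed.

Lemma average_error_bound (lam : nat -> R) (N : R -> nat) (t : R) :
  eigenvalue_sequence_S2 lam -> counting_function lam N -> 1 <= t ->
  Rabs (average_error N t - g (sqrt (t + 1 / 4))) <= 6 * / sqrt t.
Proof.
  intros Hlam HN Ht. set (x := sqrt (t + 1 / 4)). set (s := sqrt t).
  assert (Hx2 : x ^ 2 = t + 1 / 4) by (unfold x; rewrite pow2_sqrt; lra).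
  assert (Hs2 : s ^ 2 = t) by (unfold s; rewrite pow2_sqrt; lra).
  assert (Hx0 : 0 <= x) by apply sqrt_pos. assert (Hs0 : 0 <= s) by apply sqrt_pos.
  assert (Hs1 : 1 <= s) by nra. assert (Hxs : x <= s + 1 / 2) by nra.
  assert (Hx1 : 1 <= x) by nra.
  pose proof (nearest_integer x) as Hy. set (n := Int_part (x + 1 / 2)) in *.
  assert (Hn : (1 <= n)%Z).
  { assert (0 < n)%Z by (apply lt_IZR; lra). lia. }
  assert (Hm : exists m : nat, (1 <= m)%nat /\ IZR n = INR m).
  { exists (Z.to_nat n). split; [lia|]. rewrite INR_IZR_INZ, Z2Nat.id by lia. reflexivity. }
  destruct Hm as (m & Hm1 & Em).
  assert (Hm1' : 1 <= INR m) by (apply (le_INR 1); exact Hm1).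
  rewrite (g_near x n Hy). rewrite Em in *. set (y := x - INR m) in *.
  assert (Ht' : t = (INR m + y) ^ 2 - 1 / 4) by (unfold y; lra).
  (* Since t = x^2 - 1/4, the condition m - 1/2 <= x < m + 1/2 is exactly m(m-1) <= t < m(m+1). *)
  rewrite (average_error_value lam N Hlam HN m t Hm1); [|lra|split; nra].
  set (q := INR m) in *.
  (* Subtracting t times [g] cancels all terms quadratic in [q]; what remains in the numerator has
     degree one in [q], with [y] bounded. *)
  assert (E : (- (t - q ^ 2) ^ 2 / 2 + q ^ 2 / 2 - t / 3) / t - (1 / 6 - 2 * y ^ 2)
    = (2 * y ^ 2 * (2 * q * y + y ^ 2 - 1 / 4) - 2 * q * y * (y ^ 2 - 1 / 4)
       - (y ^ 2 - 1 / 4) ^ 2 / 2 - (2 * q * y + y ^ 2 - 1 / 4) / 2) / t).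
  { match goal with |- _ = ?num / t => assert (E0 : - (t - q ^ 2) ^ 2 / 2 + q ^ 2 / 2 - t / 3
        = num + (1 / 6 - 2 * y ^ 2) * t) by (rewrite Ht'; field) end.
    rewrite E0. field. lra. }
  rewrite E. unfold Rdiv. rewrite Rabs_mult, (Rabs_pos_eq (/ t)) by (left; apply Rinv_0_lt_compat; lra).
  assert (B : Rabs (2 * y ^ 2 * (2 * q * y + y ^ 2 - 1 / 4) - 2 * q * y * (y ^ 2 - 1 / 4)
       - (y ^ 2 - 1 / 4) ^ 2 / 2 - (2 * q * y + y ^ 2 - 1 / 4) / 2) <= 3 * q).
  { clearbody y q.
    assert (Y2 : 0 <= y ^ 2 <= 1 / 4) by nra.
    assert (Q : - q / 2 <= q * y <= q / 2) by nra.
    assert (Q2 : - q / 8 <= q * y * y ^ 2 <= q / 8) by nra.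
    apply Rabs_le. nra. }
  (* From q <= x + 1/2 <= s + 1 and s >= 1. Together with the bound 3q this yields the constant
     6. *)
  assert (Hq : q <= 2 * s) by (unfold y in Hy; lra).
  apply Rle_trans with (6 * s * / t).
  - apply Rmult_le_compat_r; [left; apply Rinv_0_lt_compat; lra|]. lra.
  - right. rewrite <- Hs2. field. lra.
Qed.

Theorem theorem4p2 :
  ((forall x : R, continuous g x) /\
   (forall x : R, g (x + 1) = g x) /\
   mean_value g 1 = 0) /\
  (forall (lam : nat -> R) (N : R -> nat),
     eigenvalue_sequence_S2 lam ->
     counting_function lam N ->
     exists C M : R, 0 < M /\
       forall t : R, M <= t ->
         Rabs (average_error N t - g (sqrt (t + 1 / 4)))
           <= C * Rpower t (- (1 / 2))).
Proof.
  split; [exact (conj g_continuous (conj g_periodic g_mean_value))|].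
  intros lam N Hlam HN. exists 6, 1. split; [lra|]. intros t Ht.
  replace (- (1 / 2)) with (- / 2) by field.
  rewrite Rpower_Ropp, Rpower_sqrt by lra.
  now apply average_error_bound with lam.
Qed.
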